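(* Let $H$ be a separable complex Hilbert space and let $A\in\mathcal{B}_p(H)$. Then $$2^{-\frac1p}\|A\|_p\le w_p(A)\le\|A\|_p\quad\text{for }1\le p\le2,$$ and $$2^{\frac1p-1}\|A\|_p\le w_p(A)\le\|A\|_p\quad\text{for }2\le p<\infty.$$
   Context: $\mathcal{B}_p(H)$ is the $p$-Schatten class: the compact operators $A$ on $H$ with $\|A\|_p=(\mathrm{tr}|A|^p)^{1/p}<\infty$. For $T\in\mathcal{B}(H)$, $Re(T)=\frac{T+T^*}{2}$, and $w_p(A)=\sup_{\theta\in\mathbb{R}}\|Re(e^{i\theta}A)\|_p$. *)

(* Defs.v *)
From mathcomp Require Import all_boot all_order all_algebra.
From mathcomp Require Import all_classical all_reals all_analysis.
From mathcomp Require Export complex.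

Set Implicit Arguments.
Unset Strict Implicit.
Unset Printing Implicit Defensive.

Import Order.TTheory GRing.Theory Num.Theory.
Import numFieldNormedType.Exports.

Local Open Scope classical_set_scope.
Local Open Scope complex_scope.
Local Open Scope ring_scope.

Definition separable (T : topologicalType) : Prop :=
  exists2 D : set T, countable D & dense D.

Definition expi (R : realType) (theta : R) : R[i] := cos theta +i* sin theta.

(* A complex Hilbert space is a complete normed module H over R[i] whose norm
   is induced by dot (see is_inner_product); dot is linear in its first
   argument and conjugate-linear in the second. *)
Section Operators.
Context (R : realType) (H : completeNormedModType R[i]).
Variable dot : {dot H for Num.conj}.

Definition is_inner_product : Prop := forall x : H, `|x| ^+ 2 = dot x x.

Definition bounded_operator (T : H -> H) : Prop := linear T /\ continuous T.

Definition compact_operator (T : H -> H) : Prop :=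
  linear T /\ precompact (T @` [set x | `|x| <= 1]).

(* The order of R[i] makes this include that <T x, x> is real. *)
Definition positive_operator (T : H -> H) : Prop :=
  bounded_operator T /\ forall x, 0 <= dot (T x) x.

(* Below, xget picks an element of a set of operators that is a singleton in
   the cases of interest; (fun=> 0) is a dummy value for the other cases. *)

(* Unique when it exists; it exists for every bounded T (Riesz). *)
Definition adjoint (T : H -> H) : H -> H :=
  xget (fun=> 0) [set S | forall x y, dot (T x) y = dot x (S y)].

Definition re_op (T : H -> H) : H -> H :=
  fun x => 2^-1 *: (T x + adjoint T x).

(* |T|, the unique positive square root of T^* T. *)
Definition modulus (T : H -> H) : H -> H :=
  xget (fun=> 0)
    [set S | positive_operator S /\ S \o S = adjoint T \o T].

Definition orthonormal_basis (E : set H) : Prop :=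
  (forall e f, E e -> E f -> dot e f = (e == f)%:R) /\
  (forall x, (forall e, E e -> dot x e = 0) -> x = 0).

(* T ^ p for T positive and compact, by the functional calculus of compact
   self-adjoint operators: T is diagonal, with some eigenvalues l >= 0, in some
   orthonormal basis, and T ^ p is the bounded operator that is diagonal in the
   same basis with the eigenvalues l ^ p. The result does not depend on the
   eigenbasis. *)
Definition operator_pow (T : H -> H) (p : R) : H -> H :=
  xget (fun=> 0)
    [set S | bounded_operator S /\
      exists2 E, orthonormal_basis E &
        forall e, E e -> exists l : R,
          T e = l%:C *: e /\ S e = (l `^ p)%:C *: e].

(* The trace of a positive operator, possibly +oo, computed in some orthonormal
   basis; its value does not depend on that basis. *)
Definition trace (T : H -> H) : \bar R :=
  \esum_(e in xget set0 orthonormal_basis) (complex.Re (dot (T e) e))%:E.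

Definition schatten_norm (p : R) (T : H -> H) : \bar R :=
  (trace (operator_pow (modulus T) p) `^ p^-1)%E.

Definition schatten_class (p : R) (T : H -> H) : Prop :=
  compact_operator T /\ (schatten_norm p T < +oo)%E.

Definition schatten_numerical_radius (p : R) (T : H -> H) : \bar R :=
  ereal_sup [set schatten_norm p (re_op (fun x => expi theta *: T x))
            | theta in [set: R]].

End Operators.

(* Main.v *)
(* For T compact, let E be an orthonormal basis of eigenvectors of T^* T; then
   ||T||_p^p is the sum over E of |T e|^p.  Everything rests on one majorization
   principle: if S is diagonal in an orthonormal basis with eigenvalues l_e and
   <S x, x> = sum_j |<x, w_j>|^2 for all x, then each |w_j|^2 is an average of
   the l_e with weights |<e, w_j>|^2 / l_e whose sums are at most 1 over e and
   equal to 1 over j, so Jensen compares sum_j |w_j|^(2q) with sum_e l_e^q, in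
   opposite directions for q >= 1 and q <= 1.
   Let B = Re A and C = Im A = Re (-i A), so that A^*A + AA^* = 2 (B^2 + C^2),
   and let q = p/2.  For p >= 2 the principle is applied to A^*A + AA^* with the
   w_j of the form A e and A^* e, and to B^2 and C^2; for p <= 2 it is applied to
   B^2 + C^2 with w_j of the form B e and C e, and to AA^* and A^*A.  The missing
   step is in both cases the convexity or concavity of t^q.
   For the upper bound, s_u = <B u, v> for singular vectors u, v of B, which is
   at most (|<A u, v>| + |<A v, u>|)/2, and Jensen bounds sum_u |<A u, v>|^p by
   the sum of the p-th powers of the singular values of A, with the weights
   (|<u, e>|^2 + |<v, g_e>|^2)/2 where e, g_e are singular vectors of A. *)

Require Import Defs.
From HB Require Import structures.
From mathcomp Require Import all_boot all_order all_algebra finmap.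
From mathcomp Require Import all_classical all_reals all_analysis.
From mathcomp Require Import ring lra.

Set Implicit Arguments.
Unset Strict Implicit.
Unset Printing Implicit Defensive.

Import Order.TTheory GRing.Theory Num.Theory.
Import numFieldNormedType.Exports.

Local Open Scope classical_set_scope.
Local Open Scope complex_scope.
Local Open Scope ring_scope.

(** * Squared moduli of complex numbers *)

Section ComplexModulus.
Context (R : realType).
Implicit Types z w : R[i].

Definition sqmod z : R := complex.Re z ^+ 2 + complex.Im z ^+ 2.

Lemma sqmod_ge0 z : 0 <= sqmod z.
Proof. by rewrite addr_ge0 ?sqr_ge0. Qed.

Lemma sqmod0 : sqmod 0 = 0.
Proof. by rewrite /sqmod /= !expr0n addr0. Qed.

Lemma sqmod_eq0 z : sqmod z = 0 -> z = 0.
Proof.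
case: z => a b /eqP; rewrite /sqmod /= paddr_eq0 ?sqr_ge0// !sqrf_eq0.
by move=> /andP[/eqP-> /eqP->].
Qed.

Lemma sqmodM z w : sqmod (z * w) = sqmod z * sqmod w.
Proof. by case: z w => a b [c d]; rewrite /sqmod /=; ring. Qed.

Lemma sqmodJ z : sqmod (Num.conj z) = sqmod z.
Proof. by case: z => a b; rewrite /sqmod /= sqrrN. Qed.

Lemma sqmod_real (a : R) : sqmod a%:C = a ^+ 2.
Proof. by rewrite /sqmod /= expr0n addr0. Qed.

Lemma mul_conjC z : z * Num.conj z = (sqmod z)%:C.
Proof.
by case: z => a b; apply/eqP; rewrite eq_complex /sqmod /=;
  apply/andP; split; apply/eqP; ring.
Qed.

Lemma real_complexD (a b : R) : (a + b)%:C = a%:C + b%:C.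
Proof. exact: rmorphD. Qed.

Lemma real_complexM (a b : R) : (a * b)%:C = a%:C * b%:C.
Proof. exact: rmorphM. Qed.

Lemma conjC_real (a : R) : Num.conj (a%:C : R[i]) = a%:C.
Proof. exact: conjc_real. Qed.

Lemma sqmod_norm z : `|z| = (Num.sqrt (sqmod z))%:C.
Proof. by rewrite normc_def. Qed.

Lemma ReD z w : complex.Re (z + w) = complex.Re z + complex.Re w.
Proof. by case: z w => a b []. Qed.

Lemma ReZ (a : R) z : complex.Re (a%:C * z) = a * complex.Re z.
Proof. by case: z => b c /=; rewrite mul0r subr0. Qed.

Lemma Re_ge0 z : 0 <= z -> 0 <= complex.Re z.
Proof. by rewrite lecE => /andP[]. Qed.

Lemma sqmod_Re z : complex.Re z ^+ 2 <= sqmod z.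
Proof. by rewrite lerDl sqr_ge0. Qed.

End ComplexModulus.

(** * Inner products *)

Section InnerProduct.
Context (R : realType) (H : completeNormedModType R[i]).
Variable dot : {dot H for Num.conj}.
Hypothesis dotP : is_inner_product dot.
Implicit Types x y z : H.

Lemma dotDl x y z : dot (x + y) z = dot x z + dot y z.
Proof. exact: linearDl. Qed.
Lemma dotZl a x y : dot (a *: x) y = a * dot x y.
Proof. exact: linearZl_LR. Qed.
Lemma dotC x y : dot y x = Num.conj (dot x y).
Proof. by rewrite hermC expr0 mul1r. Qed.
Lemma dotDr x y z : dot x (y + z) = dot x y + dot x z.
Proof. exact: linearDr. Qed.
Lemma dotZr a x y : dot x (a *: y) = Num.conj a * dot x y.
Proof. by rewrite dotC dotZl rmorphM /= -dotC. Qed.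
Lemma dot0l x : dot 0 x = 0.
Proof. by rewrite -(scale0r x) dotZl mul0r. Qed.
Lemma dot0r x : dot x 0 = 0.
Proof. by rewrite dotC dot0l rmorph0. Qed.
Lemma dotNl x y : dot (- x) y = - dot x y.
Proof. by rewrite -scaleN1r dotZl mulN1r. Qed.
Lemma dotNr x y : dot x (- y) = - dot x y.
Proof. by rewrite dotC dotNl rmorphN /= -dotC. Qed.

(** The norm of [H] takes values in [R[i]]; estimates use this real squared norm, to which [lra] and
    [nra] apply. *)
Definition nsq x : R := complex.Re (dot x x).

Lemma dotxx x : dot x x = (nsq x)%:C.
Proof.
have : 0 <= dot x x by exact: dnorm_ge0.
by rewrite /nsq; case: (dot x x) => a b; rewrite lecE /= => /andP[/eqP-> _].
Qed.

Lemma nsq_ge0 x : 0 <= nsq x.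
Proof. by rewrite -ler0c -dotxx; exact: dnorm_ge0. Qed.

Lemma nsq_eq0 x : nsq x = 0 -> x = 0.
Proof. by move=> h; apply/eqP; rewrite -(dnorm_eq0 dot) dotxx h. Qed.

Lemma nsq0 : nsq 0 = 0.
Proof. by rewrite /nsq dot0l. Qed.

Lemma nsq_gt0 x : x <> 0 -> 0 < nsq x.
Proof. by move=> x0; rewrite lt_def nsq_ge0 andbT; apply/eqP => /nsq_eq0. Qed.

Lemma nsqD x y : nsq (x + y) = nsq x + nsq y + complex.Re (dot x y) *+ 2.
Proof.
rewrite /nsq dotDl !dotDr (dotC x y) !ReD.
by case: (dot x y) => a b /=; ring.
Qed.

Lemma nsqN x : nsq (- x) = nsq x.
Proof. by rewrite /nsq dotNl dotNr opprK. Qed.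

Lemma nsqB x y : nsq (x - y) = nsq x + nsq y - complex.Re (dot x y) *+ 2.
Proof. by rewrite nsqD nsqN dotNr; case: (dot x y) => a b /=; ring. Qed.

Lemma nsqBC x y : nsq (x - y) = nsq (y - x).
Proof. by rewrite -nsqN opprB. Qed.

Lemma nsqZ a x : nsq (a *: x) = sqmod a * nsq x.
Proof.
by rewrite /nsq dotZl dotZr mulrA mul_conjC dotxx -real_complexM.
Qed.

Lemma nsqZr (a : R) x : nsq (a%:C *: x) = a ^+ 2 * nsq x.
Proof. by rewrite nsqZ sqmod_real. Qed.

Lemma parallelogram x y : nsq (x + y) + nsq (x - y) = nsq x *+ 2 + nsq y *+ 2.
Proof. by rewrite nsqD nsqB; ring. Qed.

Lemma nsqD_le x y : nsq (x + y) <= nsq x *+ 2 + nsq y *+ 2.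
Proof. by rewrite -parallelogram lerDl nsq_ge0. Qed.

Lemma nsqB_le z x y : nsq (x - y) <= nsq (x - z) *+ 2 + nsq (y - z) *+ 2.
Proof.
have -> : x - y = (x - z) + (z - y) by rewrite addrA subrK.
by rewrite (nsqBC y z) nsqD_le.
Qed.

Lemma norm_nsq x : `|x| = (Num.sqrt (nsq x))%:C.
Proof.
apply/eqP; rewrite -(eqrXn2 (n := 2))//; last by rewrite ler0c sqrtr_ge0.
by rewrite dotP dotxx -rmorphXn /= sqr_sqrtr ?nsq_ge0.
Qed.

Lemma norm_lt x (e : R) : 0 < e -> (`|x| < e%:C) = (nsq x < e ^+ 2).
Proof.
move=> e0; rewrite norm_nsq ltcR -[in RHS](sqr_sqrtr (nsq_ge0 x)).
by rewrite ltr_pXn2r ?nnegrE ?sqrtr_ge0 ?ltW.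
Qed.

Lemma norm_le x (e : R) : 0 <= e -> (`|x| <= e%:C) = (nsq x <= e ^+ 2).
Proof.
move=> e0; rewrite norm_nsq lecR -[in RHS](sqr_sqrtr (nsq_ge0 x)).
by rewrite ler_pXn2r ?nnegrE ?sqrtr_ge0.
Qed.

Lemma dot_inj_r x y : (forall z, dot z x = dot z y) -> x = y.
Proof.
move=> h; apply/subr0_eq/nsq_eq0.
by rewrite /nsq dotDr dotNr h subrr.
Qed.

Lemma linearS_D (S : H -> H) : linear S -> forall x y, S (x + y) = S x + S y.
Proof. by move=> lS x y; rewrite -[x]scale1r lS !scale1r. Qed.

Lemma linearS_0 (S : H -> H) : linear S -> S 0 = 0.
Proof.
by move=> lS; have := linearS_D lS 0 0; rewrite addr0 -{1}[S 0]addr0 => /addrI/esym.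
Qed.

Lemma linearS_Z (S : H -> H) : linear S -> forall a x, S (a *: x) = a *: S x.
Proof. by move=> lS a x; rewrite -[a *: x]addr0 lS linearS_0 // addr0. Qed.

Lemma linearS_B (S : H -> H) : linear S -> forall x y, S (x - y) = S x - S y.
Proof. by move=> lS x y; rewrite linearS_D// -scaleN1r linearS_Z// scaleN1r. Qed.

(* The quadratic [<S(x - s y), x - s y> >= 0] is evaluated at [s = t <S x, y>] for real [t]. *)
Lemma semi_cauchy_schwarz (S : H -> H) x y :
  linear S -> (forall u v, dot (S u) v = dot u (S v)) ->
  (forall u, 0 <= complex.Re (dot (S u) u)) ->
  sqmod (dot (S x) y)
    <= complex.Re (dot (S x) x) * complex.Re (dot (S y) y).
Proof.
move=> lS symS posS.
set a := complex.Re (dot (S x) x); set b := complex.Re (dot (S y) y).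
set c := dot (S x) y.
have b0 : 0 <= b := posS y.
have key (t : R) : 0 <= a - (t * sqmod c) *+ 2 + t ^+ 2 * sqmod c * b.
  have := posS (x - (t%:C * c) *: y).
  rewrite linearS_B// linearS_Z// !(dotDl, dotDr, dotNl, dotNr, dotZl, dotZr).
  have -> : dot (S y) x = Num.conj c by rewrite symS dotC.
  rewrite -/c rmorphM /=.
  rewrite /a /b; case: (dot (S x) x) => a1 a2; case: (dot (S y) y) => b1 b2.
  case: c => c1 c2; rewrite /sqmod /= => h; apply: le_trans h _.
  rewrite le_eqVlt; apply/orP; left; apply/eqP. simpc; ring.
have [c0|c0] := eqVneq (sqmod c) 0.
  by rewrite c0 mulr_ge0 ?posS.
have cp : 0 < sqmod c by rewrite lt_def c0 sqmod_ge0.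
have [b00|bn0] := eqVneq b 0.
  (* For [b = 0] the quadratic is affine in [t], and at this [t] it equals [- a - 2 < 0]. *)
  have := key ((a + 1) / sqmod c); rewrite b00 mulr0 addr0 divfK//.
  by have := posS x; rewrite -/a; lra.
(* The quadratic is minimal at [t = b^-1]. *)
have := key b^-1.
rewrite (_ : _ + _ = a - sqmod c / b); last by field.
by rewrite subr_ge0 ler_pdivrMr// lt_def bn0.
Qed.

Lemma cauchy_schwarz x y : sqmod (dot x y) <= nsq x * nsq y.
Proof. by apply: (@semi_cauchy_schwarz id) => // u; exact: nsq_ge0. Qed.

End InnerProduct.

(** * Convergence along filters, and boundedness *)

Section Convergence.
Context (R : realType) (H : completeNormedModType R[i]).
Variable dot : {dot H for Num.conj}.
Hypothesis dotP : is_inner_product dot.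
Implicit Types x y z : H.
Local Notation nsq := (nsq dot).

Definition tends (F : set_system H) (l : H) :=
  forall e : R, 0 < e -> F [set x | nsq (x - l) < e].

Lemma real_gt0 (e : R[i]) : 0 < e -> exists2 r : R, 0 < r & e = r%:C.
Proof.
move=> e0; have e1 : e \is Num.real by rewrite realE ltW.
by exists (complex.Re e); rewrite -?ltcR RRe_real.
Qed.

Lemma cvg_tends (F : set_system H) (l : H) : Filter F ->
  F --> l -> tends F l.
Proof.
move=> FF Fl e e0; have s0 : 0 < Num.sqrt e by rewrite sqrtr_gt0.
have /Fl : nbhs l (ball l ((Num.sqrt e)%:C)).
  by apply: nbhsx_ballx; rewrite ltcR.
apply: filterS => x; rewrite -ball_normE /= distrC (norm_lt dotP)//.
by rewrite sqr_sqrtr ?ltW.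
Qed.

Lemma cauchy_tends (F : set_system H) : ProperFilter F ->
  (forall e : R, 0 < e -> exists2 A, F A &
     forall x y, A x -> A y -> nsq (x - y) < e) ->
  exists l, tends F l.
Proof.
move=> FF FC; suff : cvg F by move/cvg_ex => [l Fl]; exists l; exact: cvg_tends.
apply/cauchy_cvgP/cauchyP => _/real_gt0[r r0 ->].
have [A FA Ae] := FC (r ^+ 2) (exprn_gt0 _ r0).
have [x Ax] := filter_ex FA.
exists x; apply: filterS FA => y Ay.
by rewrite -ball_normE /= (norm_lt dotP)// Ae.
Qed.

Lemma continuous_bounded (T : H -> H) : linear T -> continuous T ->
  exists2 c : R, 0 < c & forall x, nsq (T x) <= c * nsq x.
Proof.
move=> lT cT.
pose T' : {linear H -> H} := HB.pack T (GRing.isLinear.Build _ _ _ _ T lT).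
have /linear_boundedP : bounded_near T' (nbhs 0).
  exact/linear_bounded_continuous.
move=> /pinfty_ex_gt0[_/real_gt0[r r0 ->] Tr].
exists (r ^+ 2); first by rewrite exprn_gt0.
move=> x; have := Tr x.
rewrite !(norm_nsq dotP) -real_complexM lecR => h.
rewrite -(sqr_sqrtr (nsq_ge0 dot x)) -(sqr_sqrtr (nsq_ge0 dot (T x))) -exprMn.
by rewrite ler_pXn2r ?nnegrE ?sqrtr_ge0// mulr_ge0 ?sqrtr_ge0// ltW.
Qed.

Lemma bounded_continuous (T : H -> H) (c : R) : linear T ->
  (forall x, nsq (T x) <= c * nsq x) -> bounded_operator T.
Proof.
move=> lT Tc; split=> //.
pose T' : {linear H -> H} := HB.pack T (GRing.isLinear.Build _ _ _ _ T lT).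
suff : bounded_near T' (nbhs 0) by move/linear_bounded_continuous.
apply/bounded_funP => r; exists ((Num.sqrt `|c|)%:C * r) => x xr.
apply: (@le_trans _ _ ((Num.sqrt `|c|)%:C * `|x|)); last first.
  by rewrite ler_wpM2l// ler0c sqrtr_ge0.
rewrite !(norm_nsq dotP) -real_complexM lecR -sqrtrM//.
apply: ler_wsqrtr; apply: (le_trans (Tc x)).
by rewrite ler_wpM2r ?nsq_ge0 ?ler_norm.
Qed.

End Convergence.

(** * Projections, Riesz representation and adjoints *)

Section Riesz.
Context (R : realType) (H : completeNormedModType R[i]).
Variable dot : {dot H for Num.conj}.
Hypothesis dotP : is_inner_product dot.
Implicit Types (x y z : H) (M : set H) (T : H -> H).
Local Notation nsq := (nsq dot).

Definition lin_subset M := M 0 /\ forall a x y, M x -> M y -> M (a *: x + y).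

(** Closedness, phrased with squared distances. *)
Definition approx_closed M :=
  forall x, (forall e : R, 0 < e -> exists2 y, M y & nsq (x - y) < e) -> M x.

Lemma sqmodD_le (z w : R[i]) : sqmod (z + w) <= sqmod z *+ 2 + sqmod w *+ 2.
Proof.
case: z w => a b [c d]; rewrite /sqmod /=.
have := sqr_ge0 (a - c); have := sqr_ge0 (b - d); nra.
Qed.

Lemma le0_small (a c : R) : 0 <= c ->
  (forall e : R, 0 < e -> a <= c * e) -> a <= 0.
Proof.
move=> c0 h; rewrite leNgt; apply/negP => a0.
have e0 : 0 < a / 2 / (c + 1) by rewrite !divr_gt0// ltr_wpDl.
have := h _ e0; apply/negP; rewrite -ltNge mulrCA.
have : c / (c + 1) < 1 by rewrite ltr_pdivrMr ?mul1r ?ltrDl// ltr_wpDl.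
have : 0 <= c / (c + 1) by rewrite divr_ge0// addr_ge0.
by set k := c / _; nra.
Qed.

(** Pythagoras: the subtracted vector is the orthogonal projection of [x] on the line of [z]. *)
Lemma nsq_proj x z : z <> 0 ->
  nsq (x - (dot x z / (nsq z)%:C) *: z) = nsq x - sqmod (dot x z) / nsq z.
Proof.
move=> /(nsq_gt0 dot) z0; have zn : nsq z != 0 by rewrite gt_eqF.
rewrite nsqB nsqZ dotZr sqmodM.
have -> : ((nsq z)%:C)^-1 = (nsq z)^-1%:C by rewrite fmorphV.
rewrite sqmod_real; case: (dot x z) => a b.
by rewrite rmorphM /sqmod /=; simpc => /=; field.
Qed.

Lemma half_double x : (2^-1 : R)%:C *: (x + x) = x.
Proof.
have -> : x + x = (2 : R)%:C *: x by rewrite rmorph_nat scaler_nat.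
by rewrite scalerA -real_complexM mulVf ?scale1r// pnatr_eq0.
Qed.

(** The almost nearest points of [M] to [x0] form a Cauchy filter; its limit [l] is the nearest
    point, and [u = x0 - l]. *)
Theorem closed_subspace_orthogonal M x0 :
  lin_subset M -> approx_closed M -> ~ M x0 ->
  exists2 u, u <> 0 & forall y, M y -> dot y u = 0.
Proof.
move=> [M0 MD] Mc Mx0.
pose D := [set nsq (x0 - y) | y in M].
have infD : has_inf D.
  by split; [exists (nsq (x0 - 0)), 0|exists 0 => _ [y _ <-]; exact: nsq_ge0].
pose d := inf D.
have dle y : M y -> d <= nsq (x0 - y).
  by move=> My; apply: ge_inf; [exact: infD.2|exists y].
pose B (e : R) := [set y | M y /\ nsq (x0 - y) < d + e].
pose F := filter_from [set e : R | 0 < e] B.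
have FF : ProperFilter F.
  apply: filter_from_proper; last first.
    move=> e /= e0; have [_ [y My <-] ylt] := inf_adherent e0 infD.
    by exists y.
  apply: filter_from_filter; first by exists 1 => /=.
  move=> e f /= e0 f0; exists (Num.min e f); first by rewrite /= lt_min e0.
  move=> y [My ylt]; have [h1 h2] : Num.min e f <= e /\ Num.min e f <= f.
    by rewrite !ge_min !lexx orbT.
  by split; split=> //; lra.
have FC : forall e : R, 0 < e -> exists2 A, F A &
     forall x y, A x -> A y -> nsq (x - y) < e.
  move=> e e0; have e4 : 0 < e / 4 by rewrite divr_gt0.
  exists (B (e / 4)); first by exists (e / 4).
  move=> y y' [My ylt] [My' ylt'].
  (* The midpoint is also at squared distance at least [d], so the parallelogram law leaves less
     than [e] for [nsq (y - y')]. *)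
  have /dle : M ((2^-1 : R)%:C *: (y + y')).
    by rewrite -[_ *: _]addr0; apply: (MD) => //; rewrite -[y]scale1r; apply: MD.
  have -> : x0 - (2^-1 : R)%:C *: (y + y') = (2^-1 : R)%:C *: ((x0 - y) + (x0 - y')).
    by rewrite addrACA -opprD scalerBr half_double.
  rewrite nsqZr; have := parallelogram dot (x0 - y) (x0 - y').
  have -> : x0 - y - (x0 - y') = y' - y by rewrite opprB addrC addrA subrK.
  by rewrite (nsqBC dot y' y); lra.
have [l Fl] := cauchy_tends dotP FF FC.
have Ml : M l.
  apply: Mc => e /Fl Fle; have FM : F M by exists 1 => //= y [].
  by have [y [My yl]] := filter_ex (filterI FM Fle); exists y; rewrite // nsqBC.
exists (x0 - l) => [/subr0_eq e|z Mz]; first by rewrite e in Mx0.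
have [->|/eqP z0] := eqVneq z 0; first by rewrite dot0l.
have zp := nsq_gt0 dot z0.
apply/sqmod_eq0/eqP; rewrite eq_le sqmod_ge0 andbT.
apply: (@le0_small _ (4 * nsq z)); first by rewrite mulr_ge0 ?nsq_ge0.
move=> e e0; have FB : F (B e) by exists e.
have [y [[My ylt] yl]] := filter_ex (filterI FB (Fl _ e0)).
have -> : x0 - l = (x0 - y) + (y - l) by rewrite addrA subrK.
rewrite dotC sqmodJ dotDl; apply: (le_trans (sqmodD_le _ _)).
(* Moving [y] inside [M] along [z] can lower the squared distance by
   [sqmod (dot (x0 - y) z) / nsq z], but only [e] is available above the infimum. *)
have h1 : sqmod (dot (x0 - y) z) <= e * nsq z.
  rewrite -ler_pdivrMr//.
  have Mw : M (y + (dot (x0 - y) z / (nsq z)%:C) *: z) by rewrite addrC; apply: MD.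
  have := dle _ Mw; rewrite opprD addrA nsq_proj//; lra.
have h2 : sqmod (dot (y - l) z) <= e * nsq z.
  apply: (le_trans (cauchy_schwarz _ _ _)); rewrite ler_pM2r//; exact: ltW.
lra.
Qed.

(** Unless [phi] is zero, a multiple of a vector [u] orthogonal to the closed kernel of [phi]
    represents it. *)
Theorem riesz (phi : H -> R[i]) (c : R) :
  (forall a x y, phi (a *: x + y) = a * phi x + phi y) -> 0 <= c ->
  (forall x, sqmod (phi x) <= c * nsq x) ->
  exists z, forall x, phi x = dot x z.
Proof.
move=> lphi c0 bphi.
have phi0 : phi 0 = 0.
  by apply: sqmod_eq0; apply/eqP; rewrite eq_le sqmod_ge0 (le_trans (bphi _))// nsq0 mulr0.
have phiB x y : phi (x - y) = phi x - phi y.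
  by rewrite addrC -scaleN1r lphi mulN1r addrC.
pose M := [set x | phi x = 0].
have sM : lin_subset M by split=> //= a x y; rewrite /M /= lphi => -> ->; rewrite mulr0 addr0.
have cM : approx_closed M.
  move=> x xM; apply/sqmod_eq0/eqP; rewrite eq_le sqmod_ge0 andbT.
  apply: (@le0_small _ c) => // e e0; have [y My xy] := xM _ e0.
  have <- : phi (x - y) = phi x by rewrite phiB My subr0.
  by apply: (le_trans (bphi _)); rewrite ler_wpM2l// ltW.
have [MT|/existsNP[x0 Mx0]] := pselect (forall x, M x).
  by exists 0 => x; rewrite dot0r; exact: MT.
have [u u0 Mu] := closed_subspace_orthogonal sM cM Mx0.
have un : (nsq u)%:C != 0 by rewrite -dotxx dnorm_eq0; apply/eqP.
exists ((Num.conj (phi u) / (nsq u)%:C) *: u) => x.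
rewrite dotZr rmorphM /= conjCK fmorphV /= conjC_real.
(* This combination lies in the kernel; its product with [u] expresses [phi x] through [dot x u]. *)
have : dot (phi u *: x - phi x *: u) u = 0.
  by apply: Mu; rewrite /M /= -scaleNr lphi -[- phi x *: u]addr0 lphi phi0 addr0 mulNr mulrC subrr.
rewrite dotDl dotNl !dotZl dotxx => /subr0_eq e.
by rewrite mulrAC e mulfK.
Qed.

Definition bounded_linear T :=
  linear T /\ exists2 c : R, 0 < c & forall x, nsq (T x) <= c * nsq x.

Lemma bounded_operatorP T : bounded_operator T <-> bounded_linear T.
Proof.
split=> [[lT cT]|[lT [c c0 Tc]]]; first by split=> //; exact: (continuous_bounded dotP).
exact: (bounded_continuous dotP) lT Tc.
Qed.

Lemma adjoint_exists T : bounded_linear T ->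
  exists S, forall x y, dot (T x) y = dot x (S y).
Proof.
move=> [lT [c c0 Tc]].
suff /choice[S hS] : forall y, exists z, forall x, dot (T x) y = dot x z.
  by exists S => x y; exact: hS.
move=> y; apply: (@riesz _ (c * nsq y)); first by move=> a u v; rewrite lT dotDl dotZl.
  by rewrite mulr_ge0 ?nsq_ge0 ?ltW.
move=> x; apply: (le_trans (cauchy_schwarz _ _ _)).
by rewrite mulrAC ler_wpM2r ?nsq_ge0.
Qed.

Lemma adjointE T : bounded_linear T -> forall x y, dot (T x) y = dot x (adjoint dot T y).
Proof.
move=> /adjoint_exists[S hS].
by apply: (@xgetPex _ (fun=> 0) [set S | forall x y, dot (T x) y = dot x (S y)]); exists S.
Qed.

Lemma adjointE_r T : bounded_linear T -> forall x y, dot x (T y) = dot (adjoint dot T x) y.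
Proof. by move=> bT x y; rewrite dotC adjointE// -dotC. Qed.

Lemma adjoint_unique T S :
  (forall x y, dot (T x) y = dot x (S y)) -> adjoint dot T = S.
Proof.
move=> hS; apply/funext => y; apply: (dot_inj_r (dot := dot)) => x.
rewrite -hS; symmetry.
by apply: (@xgetPex _ (fun=> 0) [set S | forall x y, dot (T x) y = dot x (S y)]); exists S.
Qed.

(** For [y = adj T x], Cauchy-Schwarz applied to [dot (T y) x = nsq y] gives
    [nsq y ^+ 2 <= c * nsq y * nsq x]; divide by [nsq y]. *)
Lemma bounded_linear_adjoint T : bounded_linear T -> bounded_linear (adjoint dot T).
Proof.
move=> bT; have [lT [c c0 Tc]] := bT; split.
  move=> a x y; apply: (dot_inj_r (dot := dot)) => z.
  by rewrite -adjointE// !dotDr !dotZr !adjointE.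
exists c => // x; set y := adjoint dot T x.
have [/eqP y0|y0] := eqVneq y 0.
  by rewrite (eqP y0) nsq0 mulr_ge0 ?nsq_ge0 ?ltW.
have yp : 0 < nsq y by apply: nsq_gt0; exact/eqP.
have : sqmod (dot (T y) x) <= nsq (T y) * nsq x by exact: cauchy_schwarz.
rewrite adjointE// -/y dotxx sqmod_real => h.
rewrite -(ler_pM2l yp) -expr2 mulrCA mulrA; apply: (le_trans h).
by rewrite ler_wpM2r ?nsq_ge0.
Qed.

Lemma adjointK T : bounded_linear T -> adjoint dot (adjoint dot T) = T.
Proof. by move=> bT; apply: adjoint_unique => x y; rewrite adjointE_r. Qed.

Lemma bounded_linear_comp S T : bounded_linear S -> bounded_linear T -> bounded_linear (S \o T).
Proof.
move=> [lS [c c0 Sc]] [lT [d d0 Td]]; split; first by move=> a x y /=; rewrite lT lS.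
exists (c * d) => [|x /=]; first exact: mulr_gt0.
by rewrite -mulrA; apply: (le_trans (Sc _)); rewrite ler_pM2l.
Qed.

Lemma bounded_linearD S T : bounded_linear S -> bounded_linear T ->
  bounded_linear (fun x => S x + T x).
Proof.
move=> [lS [c c0 Sc]] [lT [d d0 Td]]; split.
  by move=> a x y; rewrite lT lS scalerDr addrACA.
exists (c *+ 2 + d *+ 2) => [|x /=]; first by rewrite addr_gt0 ?pmulrn_lgt0.
apply: (le_trans (nsqD_le _ _ _)).
by rewrite mulrDl !mulrnAl lerD// lerMn2r ?Sc ?Td orbT.
Qed.

Lemma bounded_linearZ (a : R[i]) T : bounded_linear T -> bounded_linear (fun x => a *: T x).
Proof.
move=> [lT [d d0 Td]]; split.
  by move=> b x y; rewrite lT scalerDr !scalerA mulrC.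
exists (sqmod a * d + 1) => [|x /=].
  by rewrite ltr_wpDl// mulr_ge0 ?sqmod_ge0 ?ltW.
rewrite nsqZ [leRHS]mulrDl mul1r -mulrA (le_trans (ler_wpM2l (sqmod_ge0 _) (Td x)))//.
by rewrite lerDl nsq_ge0.
Qed.

End Riesz.

(** * Orthonormal bases and diagonal operators *)

Section EsumSeq.
Context (R : realType) (I : choiceType).
Implicit Types (J : set I) (a : I -> R) (s : seq I).

(** An [esum] is the supremum of its finite subsums; this lemma and [esum_ge_seq] express that with
    duplicate-free sequences. *)
Lemma esum_le_seq J a (M : \bar R) :
  (forall s, uniq s -> (forall i, i \in s -> J i) ->
    ((\sum_(i <- s) a i)%:E <= M)%E) ->
  (\esum_(i in J) (a i)%:E <= M)%E.
Proof.
move=> h; apply: ge_ereal_sup => _ [X [finX XJ] <-].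
rewrite fsbig_finite//= sumEFin; apply: h; first exact: fset_uniq.
by move=> i; rewrite in_fset_set// inE; exact: XJ.
Qed.

Lemma esum_ge_seq J a s : uniq s -> (forall i, i \in s -> J i) ->
  ((\sum_(i <- s) a i)%:E <= \esum_(i in J) (a i)%:E)%E.
Proof.
move=> us sJ; apply: esum_ge; exists [set` s].
  by split; [exact: finite_seq|move=> i /=; exact: sJ].
rewrite fsbig_finite//= sumEFin lee_fin le_eqVlt; apply/orP; left; apply/eqP.
apply: perm_big; apply: uniq_perm => // i.
by rewrite in_fset_set//; apply/idP/idP; rewrite inE.
Qed.

Lemma sum_subseq_le a s t : uniq s -> uniq t -> {subset s <= t} ->
  (forall i, 0 <= a i) -> \sum_(i <- s) a i <= \sum_(i <- t) a i.
Proof.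
move=> us ut st a0; rewrite [leRHS](bigID (mem s))/=.
have -> : \sum_(i <- s) a i = \sum_(i <- t | i \in s) a i.
  rewrite -[RHS]big_filter; apply: perm_big; apply: uniq_perm => //.
    exact: filter_uniq.
  by move=> i; rewrite mem_filter; case: (boolP (i \in s)) => // /st.
by rewrite lerDl sumr_ge0.
Qed.

End EsumSeq.

Section Orthonormal.
Context (R : realType) (H : completeNormedModType R[i]).
Variable dot : {dot H for Num.conj}.
Hypothesis dotP : is_inner_product dot.
Implicit Types (x y z : H) (E : set H).
Local Notation nsq := (nsq dot).

Lemma dot_suml (I : Type) (s : seq I) (c : I -> R[i]) (v : I -> H) y :
  dot (\sum_(i <- s) c i *: v i) y = \sum_(i <- s) c i * dot (v i) y.
Proof.
elim: s => [|i s IH]; first by rewrite !big_nil dot0l.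
by rewrite !big_cons dotDl dotZl IH.
Qed.

Lemma Re_sum (I : Type) (s : seq I) (c : I -> R[i]) :
  complex.Re (\sum_(i <- s) c i) = \sum_(i <- s) complex.Re (c i).
Proof.
elim: s => [|i s IH]; first by rewrite !big_nil.
by rewrite !big_cons ReD IH.
Qed.

Definition orthonormal_family (I : choiceType) (J : set I) (v : I -> H) :=
  forall i j, J i -> J j -> dot (v i) (v j) = (i == j)%:R.

Section Family.
Context (I : choiceType) (J : set I) (v : I -> H).
Hypothesis vON : orthonormal_family J v.
Implicit Types (s : seq I) (c : I -> R[i]).

Lemma dot_comb s c j : uniq s -> (forall i, i \in s -> J i) -> J j ->
  dot (\sum_(i <- s) c i *: v i) (v j) = if j \in s then c j else 0.
Proof.
move=> us sJ Jj; rewrite dot_suml big_seq.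
rewrite (eq_bigr (fun i => c i * (i == j)%:R)); last first.
  by move=> i si; rewrite vON//; exact: sJ.
rewrite -big_seq; case: ifPn => js.
  rewrite (bigD1_seq j)//= eqxx mulr1 big1 ?addr0// => i /negPf ->.
  by rewrite mulr0.
rewrite big_seq big1// => i si; case: eqP => [ij|_]; last by rewrite mulr0.
by rewrite -ij si in js.
Qed.

Lemma nsq_comb s c : uniq s -> (forall i, i \in s -> J i) ->
  nsq (\sum_(i <- s) c i *: v i) = \sum_(i <- s) sqmod (c i).
Proof.
move=> us sJ; rewrite /nsq; set w := \sum_(i <- s) _; rewrite {1}/w.
rewrite dot_suml Re_sum big_seq [RHS]big_seq.
apply: eq_bigr => i si; rewrite (dotC dot w) dot_comb//; last exact: sJ.
by rewrite si mul_conjC.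
Qed.

Lemma nsqB_comb s x : uniq s -> (forall i, i \in s -> J i) ->
  nsq (x - \sum_(i <- s) dot x (v i) *: v i)
    = nsq x - \sum_(i <- s) sqmod (dot x (v i)).
Proof.
move=> us sJ; rewrite nsqB nsq_comb// dotC dot_suml.
have -> : \sum_(i <- s) dot x (v i) * dot (v i) x
    = (\sum_(i <- s) sqmod (dot x (v i)))%:C.
  by rewrite rmorph_sum /=; apply: eq_bigr => i _; rewrite (dotC dot x) mul_conjC.
by rewrite conjC_real /=; ring.
Qed.

Lemma bessel_seq s x : uniq s -> (forall i, i \in s -> J i) ->
  \sum_(i <- s) sqmod (dot x (v i)) <= nsq x.
Proof. by move=> us sJ; rewrite -subr_ge0 -nsqB_comb// nsq_ge0. Qed.

Lemma bessel x : (\esum_(i in J) (sqmod (dot x (v i)))%:E <= (nsq x)%:E)%E.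
Proof. by apply: esum_le_seq => s us sJ; rewrite lee_fin bessel_seq. Qed.

End Family.

Lemma basis_orthonormal E : orthonormal_basis dot E -> orthonormal_family E id.
Proof. by move=> [h _] e f Ee Ef; exact: h. Qed.

Lemma basis_inj E x y : orthonormal_basis dot E ->
  (forall e, E e -> dot x e = dot y e) -> x = y.
Proof.
move=> [_ h] xy; apply/subr0_eq/h => e Ee.
by rewrite dotDl dotNl xy// subrr.
Qed.

(** Otherwise a nonzero vector orthogonal to [M], hence to [E], would contradict the completeness of
    [E]. It serves as an induction principle for vectors. *)
Lemma lin_subset_basis E (M : set H) : orthonormal_basis dot E ->
  lin_subset M -> approx_closed dot M -> E `<=` M -> forall x, M x.
Proof.
move=> bE sM cM EM x; apply: contrapT => Mx.
have [u u0 Mu] := closed_subspace_orthogonal dotP sM cM Mx.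
by apply: u0; apply: bE.2 => e Ee; rewrite dotC Mu ?rmorph0//; exact: EM.
Qed.

(** The vectors that finite Fourier sums approximate form a closed subspace containing [E]. *)
Lemma basis_approx E x (eps : R) : orthonormal_basis dot E -> 0 < eps ->
  exists s, [/\ uniq s, forall e, e \in s -> E e &
    nsq (x - \sum_(e <- s) dot x e *: e) < eps].
Proof.
move=> bE eps0; have oE := basis_orthonormal bE.
pose P s y : H := \sum_(e <- s) dot y e *: e.
have PB s y z : P s (y - z) = P s y - P s z.
  rewrite /P -sumrB; apply: eq_bigr => e _.
  by rewrite dotDl dotNl scalerBl.
have PZ s a y z : P s (a *: y + z) = a *: P s y + P s z.
  rewrite /P scaler_sumr -big_split /=; apply: eq_bigr => e _.
  by rewrite dotDl dotZl scalerDl scalerA.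
pose D := [set y | forall e : R, 0 < e -> exists s,
  [/\ uniq s, forall i, i \in s -> E i & nsq (y - P s y) < e]].
(* Enlarging the index set never worsens the approximation, so two finite sets can be merged. *)
have Pmono s t y : uniq s -> uniq t -> (forall i, i \in t -> E i) ->
    {subset s <= t} -> nsq (y - P t y) <= nsq (y - P s y).
  move=> us ut tE st; have sE i : i \in s -> E i by move/st/tE.
  rewrite !(nsqB_comb oE)// lerB// sum_subseq_le// => i; exact: sqmod_ge0.
have sD : lin_subset D.
  split=> [e e0|a y z Dy Dz e e0].
    exists [::]; split=> //; rewrite /P big_nil subrr nsq0//.
  (* The [+ 1] keeps the divisor positive when [a = 0]. *)
  pose k := sqmod a + 1; have k0 : 0 < k by rewrite ltr_wpDl ?sqmod_ge0.
  have [s [us sE hs]] := Dy (e / 4 / k) (divr_gt0 (divr_gt0 e0 (ltr0n _ 4)) k0).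
  have [t [ut tE ht]] := Dz (e / 4) (divr_gt0 e0 (ltr0n _ 4)).
  pose r := undup (s ++ t); have ur : uniq r by exact: undup_uniq.
  have rE i : i \in r -> E i by rewrite mem_undup mem_cat => /orP[/sE|/tE].
  exists r; split=> //.
  have hs' : nsq (y - P r y) < e / 4 / k.
    apply: le_lt_trans hs; apply: Pmono => // i si.
    by rewrite mem_undup mem_cat si.
  have ht' : nsq (z - P r z) < e / 4.
    apply: le_lt_trans ht; apply: Pmono => // i si.
    by rewrite mem_undup mem_cat si orbT.
  rewrite PZ opprD addrACA -scalerBr.
  apply: (le_lt_trans (nsqD_le _ _ _)); rewrite nsqZ.
  have : sqmod a * nsq (y - P r y) <= e / 4.
    move: hs'; rewrite ltr_pdivlMr// => /ltW; apply: le_trans.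
    by rewrite mulrC ler_wpM2l ?nsq_ge0// lerDl.
  lra.
have cD : approx_closed dot D.
  move=> y hy e e0; have [z Dz yz] := hy (e / 4) (divr_gt0 e0 (ltr0n _ 4)).
  have [s [us sE hs]] := Dz (e / 4) (divr_gt0 e0 (ltr0n _ 4)).
  exists s; split=> //.
  have -> : y - P s y = ((y - z) - P s (y - z)) + (z - P s z).
    by rewrite PB opprB addrAC [_ + (z - _)]addrA subrK addrA subrK.
  apply: (le_lt_trans (nsqD_le _ _ _)).
  have : nsq (y - z - P s (y - z)) <= nsq (y - z).
    by rewrite (nsqB_comb oE)// lerBlDr lerDl sumr_ge0// => i _; exact: sqmod_ge0.
  lra.
have ED : E `<=` D.
  move=> e Ee k k0; exists [:: e]; split=> //.
    by move=> i; rewrite inE => /eqP ->.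
  by rewrite /P big_seq1 oE// eqxx scale1r subrr nsq0.
exact: (lin_subset_basis bE sD cD ED x eps eps0).
Qed.

(** Bessel gives one inequality; in the other, the defect of a finite sum is the squared error of
    the Fourier approximation, which is arbitrarily small. *)
Lemma parseval E x : orthonormal_basis dot E ->
  (\esum_(e in E) (sqmod (dot x e))%:E = (nsq x)%:E)%E.
Proof.
move=> bE; have oE := basis_orthonormal bE; apply/eqP; rewrite eq_le bessel//=.
apply/lee_addgt0Pr => r r0; have [s [us sE hs]] := basis_approx x bE r0.
have := esum_ge_seq (fun e => sqmod (dot x e)) us sE.
move: hs; rewrite (nsqB_comb oE)// ltrBlDr addrC -lte_fin EFinD => /ltW h1 h2.
by apply: (le_trans h1); rewrite leeD2r.
Qed.

(** The vectors that possess an image with the prescribed coefficients form a closed subspace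
    containing [E]. *)
Lemma diagonal_operator E (m : H -> R) (c : R) : orthonormal_basis dot E ->
  (forall e, E e -> 0 <= m e <= c) ->
  exists S, bounded_linear dot S /\
    (forall x e, E e -> dot (S x) e = (m e)%:C * dot x e).
Proof.
move=> bE mc; have oE := basis_orthonormal bE.
pose matches x z := forall e, E e -> dot z e = (m e)%:C * dot x e.
pose k := c ^+ 2 + 1; have k0 : 0 < k by rewrite ltr_wpDl ?sqr_ge0.
have mk e : E e -> m e ^+ 2 <= k.
  move=> /mc/andP[m0 mec]; rewrite /k; nra.
have matchB x z x' z' : matches x z -> matches x' z' -> matches (x - x') (z - z').
  by move=> h h' e Ee; rewrite !dotDl !dotNl h// h'// mulrBr.
have bnd x z : matches x z -> nsq z <= k * nsq x.
  move=> h; rewrite -lee_fin -(parseval z bE); apply: esum_le_seq => s us sE.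
  rewrite lee_fin; apply: (@le_trans _ _ (k * \sum_(i <- s) sqmod (dot x i))).
    rewrite mulr_sumr big_seq [leRHS]big_seq; apply: ler_sum => e /sE Ee.
    by rewrite h// sqmodM sqmod_real ler_wpM2r ?sqmod_ge0 ?mk.
  by rewrite ler_pM2l// (bessel_seq oE).
pose D := [set x | exists z, matches x z].
have sD : lin_subset D.
  split; first by exists 0 => e Ee; rewrite !dot0l mulr0.
  move=> a x y [z xz] [w yw]; exists (a *: z + w) => e Ee.
  by rewrite !dotDl !dotZl xz// yw// mulrDr mulrCA.
have cD : approx_closed dot D.
  move=> x hx.
  (* Images of vectors close to [x]; by [bnd] they form a Cauchy filter, whose limit is the image of
     [x]. *)
  pose B (r : R) := [set z | exists2 y, matches y z & nsq (x - y) < r].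
  pose F := filter_from [set e : R | 0 < e] B.
  have FF : ProperFilter F.
    apply: filter_from_proper; last first.
      by move=> r /hx[y [z yz] xy]; exists z, y.
    apply: filter_from_filter; first by exists 1 => /=.
    move=> e f /= e0 f0; exists (Num.min e f); first by rewrite /= lt_min e0.
    move=> z [y yz]; rewrite lt_min => /andP[h1 h2].
    by split; exists y.
  have [l Fl] : exists l, tends dot F l.
    apply: (cauchy_tends dotP) => r r0.
    have r4 : 0 < r / 4 / k by rewrite !divr_gt0.
    exists (B (r / 4 / k)); first by exists (r / 4 / k).
    move=> z z' [y yz xy] [y' yz' xy'].
    apply: (le_lt_trans (bnd _ _ (matchB _ _ _ _ yz yz'))).
    have := nsqB_le dot x y y'; rewrite (nsqBC _ y x) (nsqBC _ y' x) => h.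
    rewrite mulrC -ltr_pdivlMr//; apply: (le_lt_trans h).
    have -> : r / k = 4 * (r / 4 / k) by field; rewrite gt_eqF.
    lra.
  exists l => e Ee; apply/subr0_eq/sqmod_eq0/eqP; rewrite eq_le sqmod_ge0 andbT.
  have e1 : nsq e = 1 by rewrite /nsq oE// eqxx.
  apply: (@le0_small _ _ (2 + k *+ 2)).
    by rewrite addr_ge0// mulrn_wge0// ltW.
  move=> r r0; have FB : F (B r) by exists r.
  have [z [[y yz xy] zl]] := filter_ex (filterI FB (Fl _ r0)).
  have -> : dot l e - (m e)%:C * dot x e
      = dot (l - z) e + (m e)%:C * dot (y - x) e.
    by rewrite !dotDl !dotNl mulrBr yz// addrA subrK.
  apply: (le_trans (sqmodD_le _ _)); rewrite sqmodM sqmod_real.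
  have h1 : sqmod (dot (l - z) e) <= r.
    apply: (le_trans (cauchy_schwarz _ _ _)).
    by rewrite e1 mulr1 nsqBC ltW.
  have h2 : m e ^+ 2 * sqmod (dot (y - x) e) <= k * r.
    apply: ler_pM; rewrite ?sqr_ge0 ?sqmod_ge0 ?mk//.
    apply: (le_trans (cauchy_schwarz _ _ _)).
    by rewrite e1 mulr1 nsqBC ltW.
  lra.
have ED : E `<=` D.
  move=> e Ee; exists ((m e)%:C *: e) => f Ef; rewrite dotZl.
  by rewrite oE//; case: eqP => [->|] //; rewrite !mulr0.
have /choice[S hS] := lin_subset_basis bE sD cD ED.
exists S; split=> [|x e Ee]; last exact: hS.
split; last by exists k => // x; apply: bnd; exact: hS.
move=> a x y; apply: (basis_inj bE) => e Ee.
by rewrite dotDl dotZl !hS// dotDl dotZl mulrDr mulrCA.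
Qed.

Lemma diagonal_eigen E (m : H -> R) (S : H -> H) : orthonormal_basis dot E ->
  (forall x e, E e -> dot (S x) e = (m e)%:C * dot x e) ->
  forall e, E e -> S e = (m e)%:C *: e.
Proof.
move=> bE hS e Ee; apply: (basis_inj bE) => f Ef.
rewrite hS// dotZl (basis_orthonormal bE)//.
by case: eqP => [->//|_]; rewrite !mulr0.
Qed.

End Orthonormal.

(** * Compact operators and the spectral theorem *)

Lemma subrACA (V : zmodType) (a b c d : V) : a - b - (c - d) = a - c - (b - d).
Proof. by rewrite !opprB addrACA [- b - c]addrC addrACA. Qed.

Section Spectral.
Context (R : realType) (H : completeNormedModType R[i]).
Variable dot : {dot H for Num.conj}.
Hypothesis dotP : is_inner_product dot.
Implicit Types (x y z : H) (S T : H -> H).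
Local Notation nsq := (nsq dot).
Local Notation bounded_linear := (bounded_linear dot).
Local Notation adj := (adjoint dot).

(* In this ultrafilter form, compactness passes to sums, compositions and
   adjoints without handling closures of images. *)
Definition ucompact T := forall U : set_system H, UltraFilter U ->
  U [set x | nsq x <= 1] -> exists l, tends dot (fmap T U) l.

(** If [U] omits the preimage of [A], it contains the preimage of the complement; a finer proper
    filter cannot then contain [A]. *)
Lemma ultra_fmap T (U : set_system H) : UltraFilter U -> UltraFilter (fmap T U).
Proof.
move=> UU; split; first exact: fmap_proper_filter.
move=> G GG sG; apply/seteqP; split=> // A GA.
have [//|nUA] := in_ultra_setVsetC (T @^-1` A) UU.
have : G (~` A) by apply: sG.
by move=> /(filterI GA); rewrite setICr => /filter_ex[].
Qed.

Lemma ucompact_scale T (r : R) (U : set_system H) : linear T -> ucompact T ->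
  UltraFilter U -> U [set x | nsq x <= r] -> exists l, tends dot (fmap T U) l.
Proof.
move=> lT cT UU Ur.
(* Dividing by [k] moves the ball of squared radius [r] into the unit ball; the [+ 1] makes [k]
   nonzero. *)
pose k := Num.sqrt (`|r| + 1); have k0 : 0 < k by rewrite sqrtr_gt0 ltr_wpDl.
have k2 : k ^+ 2 = `|r| + 1 by rewrite sqr_sqrtr// addr_ge0.
pose f x := (k^-1)%:C *: x.
have [l hl] : exists l, tends dot (fmap T (fmap f U)) l.
  apply: cT; first exact: ultra_fmap.
  rewrite /fmap /=; apply: filterS Ur => x /= xr; rewrite /f nsqZr exprVn k2 ler_pdivrMl ?mulr1.
    by apply: (le_trans xr); rewrite (le_trans (ler_norm _))// lerDl.
  by rewrite ltr_wpDl.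
exists (k%:C *: l) => e e0; have ek : 0 < e / k ^+ 2 by rewrite divr_gt0 ?exprn_gt0.
have := hl _ ek; rewrite /fmap /=; apply: filterS => x /=.
rewrite ltr_pdivlMr ?exprn_gt0// mulrC -nsqZr scalerBr /f linearS_Z// scalerA.
by rewrite -real_complexM divff ?gt_eqF// scale1r.
Qed.

Lemma compact_ucompact T : compact_operator T -> ucompact T.
Proof.
move=> [_]; rewrite precompactE compact_ultra => cK U UU UB.
have UT := ultra_fmap T UU.
have [|p [_ Up]] := cK (fmap T U) UT; last by exists p; exact: cvg_tends.
rewrite /fmap /=; apply: filterS UB => x /= x1; apply: subset_closure; exists x => //=.
by rewrite -[1]/(1%:C) (norm_le dotP)// expr1n.
Qed.

(** If [T] were unbounded on the unit ball, an ultrafilter would contain every set [B c], and [T]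
    could not converge along it. *)
Lemma ucompact_bounded T : linear T -> ucompact T -> bounded_linear T.
Proof.
move=> lT cT; split=> //.
suff [c hc] : exists c : R, forall x, nsq x <= 1 -> nsq (T x) <= c.
  exists (`|c| + 1); first by rewrite ltr_wpDl.
  move=> x; have [->|/eqP x0] := eqVneq x 0; first by rewrite linearS_0// nsq0 mulr0.
  have xp := nsq_gt0 dot x0.
  have /hc : nsq ((Num.sqrt (nsq x))^-1%:C *: x) <= 1.
    by rewrite nsqZr exprVn sqr_sqrtr ?nsq_ge0// mulVf ?gt_eqF.
  rewrite linearS_Z// nsqZr exprVn sqr_sqrtr ?nsq_ge0// ler_pdivrMl// => h.
  apply: (le_trans h); rewrite mulrC ler_wpM2r ?nsq_ge0//.
  by rewrite (le_trans (ler_norm _))// lerDl.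
apply: contrapT => nb.
pose B (c : R) := [set x | nsq x <= 1 /\ c < nsq (T x)].
pose F := filter_from [set: R] B.
have FF : ProperFilter F.
  apply: filter_from_proper; last first.
    move=> c _; apply: contrapT => nB; apply: nb; exists c => x x1.
    by rewrite leNgt; apply/negP => cx; apply: nB; exists x.
  apply: filter_from_filter; first by exists 0.
  move=> c d _ _; exists (Num.max c d) => // x [x1].
  by rewrite gt_max => /andP[h1 h2]; split; split.
have [U [UU FU]] := ultraFilterLemma FF.
have [l hl] : exists l, tends dot (fmap T U) l.
  by apply: cT => //; apply: FU; exists 0 => // x [].
(* By [nsqD_le] this threshold cannot be exceeded by [nsq (T x)] when [nsq (T x - l) < 1]. *)
have UB : U (B (2 + nsq l *+ 2)) by apply: FU; exists (2 + nsq l *+ 2).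
have US : U [set x | nsq (T x - l) < 1] := hl _ ltr01.
have [x [/= [_ xb] xl]] := filter_ex (filterI UB US).
have := nsqD_le dot (T x - l) l; rewrite subrK; lra.
Qed.

Lemma ucompact_compl S T : bounded_linear S -> ucompact T -> ucompact (S \o T).
Proof.
move=> [lS [c c0 Sc]] cT U UU UB; have [l hl] := cT U UU UB.
exists (S l) => e e0; have ec : 0 < e / c by rewrite divr_gt0.
have := hl _ ec; rewrite /fmap /=; apply: filterS => x /=; rewrite ltr_pdivlMr// mulrC => h.
by apply: le_lt_trans h; rewrite -linearS_B.
Qed.

Lemma ucompact_compr S T : bounded_linear S -> linear T -> ucompact T -> ucompact (T \o S).
Proof.
move=> [lS [c c0 Sc]] lT cT U UU UB.
have [l hl] : exists l, tends dot (fmap T (fmap S U)) l.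
  apply: (ucompact_scale (r := c) lT cT); first exact: ultra_fmap.
  rewrite /fmap /=; apply: filterS UB => x /= x1; apply: (le_trans (Sc x)).
  by rewrite -[leRHS]mulr1 ler_pM2l.
by exists l.
Qed.

Lemma ucompactD S T : ucompact S -> ucompact T -> ucompact (fun x => S x + T x).
Proof.
move=> cS cT U UU UB; have [l hl] := cS U UU UB; have [m hm] := cT U UU UB.
exists (l + m) => e e0; have e4 : 0 < e / 4 by rewrite divr_gt0.
have US : U [set x | nsq (S x - l) < e / 4] := hl _ e4.
have UT : U [set x | nsq (T x - m) < e / 4] := hm _ e4.
rewrite /fmap /=; apply: filterS (filterI US UT) => x /= [h1 h2].
rewrite opprD addrACA; apply: (le_lt_trans (nsqD_le _ _ _)); lra.
Qed.

Lemma ucompactZ a T : ucompact T -> ucompact (fun x => a *: T x).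
Proof.
move=> cT; apply: (@ucompact_compl (fun x => a *: x)) => //.
by apply: (@bounded_linearZ _ _ _ a id); split=> //; exists 1 => // x; rewrite mul1r.
Qed.

(** On the unit ball, the hypothesis turns the Cauchy property of the images under [B] into that of
    the images under [A]. *)
Lemma ucompact_dominated A B : linear A -> linear B -> ucompact B ->
  (forall x, nsq (A x) ^+ 2 <= nsq (B x) * nsq x) -> ucompact A.
Proof.
move=> lA lB cB AB U UU UB; have [l hl] := cB U UU UB.
have FT := ultra_fmap A UU.
apply: (cauchy_tends dotP) => e e0.
(* For [z = x - y] this gives [nsq (B z) < e ^+ 2 / 8] and [nsq z <= 4], so [nsq (A z) ^+ 2] is
   below [e ^+ 2]. *)
have d0 : 0 < e ^+ 2 / 32 by rewrite divr_gt0 ?exprn_gt0.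
pose D := [set x | nsq (B x - l) < e ^+ 2 / 32] `&` [set x | nsq x <= 1].
exists (A @` D).
  have : U D by apply: filterI => //; exact: hl.
  by rewrite /fmap /=; apply: filterS => x Dx; exists x.
move=> _ _ [x [/= x1 x2] <-] [y [/= y1 y2] <-]; rewrite -linearS_B//.
have xy := nsqB_le dot 0 x y; rewrite !subr0 in xy.
have Bxy := nsqB_le dot l (B x) (B y).
set z := x - y in xy *.
rewrite -(ltr_pXn2r (n := 2)) ?nnegrE ?nsq_ge0 ?ltW//.
apply: (le_lt_trans (AB z)).
have : nsq (B z) < e ^+ 2 / 8 by rewrite (linearS_B lB); lra.
have := nsq_ge0 dot (B z); have := nsq_ge0 dot z.
by move: (nsq z) (nsq (B z)) xy => a b; nra.
Qed.

(** [nsq (adj T x) = dot (T (adj T x)) x], so [adj T] is dominated by the compact operator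
    [T \o adj T]. *)
Lemma ucompact_adjoint T : linear T -> ucompact T -> ucompact (adj T).
Proof.
move=> lT cT; have bT := ucompact_bounded lT cT; have bT' := bounded_linear_adjoint dotP bT.
have bTT := bounded_linear_comp bT bT'.
apply: (ucompact_dominated bT'.1 bTT.1 (ucompact_compr bT' lT cT)) => x /=.
have := cauchy_schwarz dot (T (adj T x)) x.
by rewrite (adjointE dotP)// dotxx sqmod_real.
Qed.

Section PositiveOperator.
Context (S : H -> H).
Hypotheses (bS : bounded_linear S) (cS : ucompact S)
  (symS : forall x y, dot (S x) y = dot x (S y))
  (posS : forall x, 0 <= complex.Re (dot (S x) x)).

Let lS : linear S := bS.1.
Let q x := complex.Re (dot (S x) x).

Lemma quad_scale (a : R) x : q (a%:C *: x) = a ^+ 2 * q x.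
Proof.
by rewrite /q linearS_Z// dotZl dotZr conjC_real mulrA -real_complexM ReZ.
Qed.

(** Let [m] be the supremum of [q] on the unit sphere of [M]. Along a maximizing ultrafilter
    [S x - m x] tends to 0, and compactness makes [S x], hence [x] when [m > 0], converge. *)
Lemma exists_eigenvector (M : set H) x0 : lin_subset M -> approx_closed dot M ->
  (forall x, M x -> M (S x)) -> M x0 -> x0 <> 0 ->
  exists e, [/\ M e, e <> 0 & exists m : R, S e = m%:C *: e].
Proof.
move=> [M0 MD] cM SM Mx0 x00.
have MZ a x : M x -> M (a *: x) by move=> Mx; rewrite -[_ *: _]addr0; exact: MD.
have unit x : x <> 0 -> nsq ((Num.sqrt (nsq x))^-1%:C *: x) = 1.
  move=> /(nsq_gt0 dot) xp.
  by rewrite nsqZr exprVn sqr_sqrtr ?nsq_ge0// mulVf ?gt_eqF.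
pose D := [set q x | x in [set x | M x /\ nsq x = 1]].
have [c c0 Sc] := bS.2.
have supD : has_sup D.
  split.
    pose u := (Num.sqrt (nsq x0))^-1%:C *: x0.
    by exists (q u), u => //; split; [exact: MZ|exact: unit].
  exists (c + 1) => _ [x [Mx x1] <-].
  have h : q x ^+ 2 <= c.
    apply: (le_trans (sqmod_Re _)); apply: (le_trans (cauchy_schwarz _ _ _)).
    by rewrite x1 mulr1 (le_trans (Sc x))// x1 mulr1.
  by have := posS x; rewrite -/(q x); nra.
pose m := sup D.
have qm x : M x -> q x <= m * nsq x.
  move=> Mx; have [->|/eqP xn0] := eqVneq x 0.
    by rewrite /q linearS_0// dot0l nsq0 mulr0.
  have : q ((Num.sqrt (nsq x))^-1%:C *: x) <= m.
    apply: ub_le_sup; first exact: supD.2.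
    exists ((Num.sqrt (nsq x))^-1%:C *: x) => //.
    by split; [exact: MZ|exact: unit].
  rewrite quad_scale exprVn sqr_sqrtr ?nsq_ge0// ler_pdivrMl 1?mulrC//.
  exact: nsq_gt0.
(* Semi-Cauchy-Schwarz at [x] and [S x] gives [nsq (S x) ^+ 2 <= q x * q (S x)], and
   [q (S x) <= m * nsq (S x)]. *)
have Sqm x : M x -> nsq (S x) <= m * q x.
  move=> Mx; have [->|/eqP Sx0] := eqVneq (S x) 0.
    have m0 : 0 <= m.
      have := le_trans (posS x0) (qm _ Mx0).
      by rewrite pmulr_lge0//; exact: nsq_gt0.
    by rewrite nsq0 mulr_ge0// posS.
  have Sp := nsq_gt0 dot Sx0.
  have := semi_cauchy_schwarz x (S x) lS symS posS.
  rewrite dotxx sqmod_real -/(q x) -/(q (S x)) => h.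
  rewrite -(ler_pM2l Sp) -expr2; apply: (le_trans h).
  rewrite mulrCA [leRHS]mulrC -mulrA mulrC mulrAC.
  have := qm _ (SM _ Mx); have := posS x; rewrite -/(q x); nra.
(* If [m <= 0], then [S x0 = 0] and [x0] itself is an eigenvector. *)
have [m0|m0] := ltP 0 m; last first.
  exists x0; split=> //; exists 0; rewrite scale0r; apply/nsq_eq0/eqP.
  rewrite eq_le nsq_ge0 andbT; apply: (le_trans (Sqm _ Mx0)).
  by rewrite mulr_le0_ge0// posS.
pose B (e : R) := [set x | [/\ M x, nsq x = 1 & m - e < q x]].
pose F := filter_from [set e : R | 0 < e] B.
have FF : ProperFilter F.
  apply: filter_from_proper; last first.
    by move=> e /= e0; have [_ [x [Mx x1] <-] ?] := sup_adherent e0 supD; exists x.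
  apply: filter_from_filter; first by exists 1 => /=.
  move=> e f /= e0 f0; exists (Num.min e f); first by rewrite /= lt_min e0.
  move=> x [Mx x1 xq]; have [h1 h2] : Num.min e f <= e /\ Num.min e f <= f.
    by rewrite !ge_min !lexx orbT.
  by split; split=> //; lra.
have [U [UU FU]] := ultraFilterLemma FF.
have [l hl] : exists l, tends dot (fmap S U) l.
  by apply: cS => //; apply: FU; exists 1 => //= x [_ x1 _] /=; rewrite x1.
(* For a unit vector, [Sqm] bounds [nsq (S x - m x)] by [m * (m - q x)]. The factor [m ^+ 2] in [d]
   pays for the division by [m]. *)
have eig (e : R) : 0 < e -> U [set x | [/\ M x, nsq x = 1 &
    nsq (S x - m%:C *: x) < e /\ nsq (x - m^-1%:C *: l) < e]].
  move=> e0; pose d := Num.min e (m ^+ 2 * e) / 4.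
  have dp : 0 < d by rewrite divr_gt0// lt_min e0 mulr_gt0// exprn_gt0.
  have d1 : d * 4 <= e by rewrite divfK// ge_min lexx.
  have d2 : d * 4 <= m ^+ 2 * e by rewrite divfK// ge_min lexx orbT.
  have UB : U (B (d / m)) by apply: FU; exists (d / m) => //; exact: divr_gt0.
  have US : U [set x | nsq (S x - l) < d] := hl _ dp.
  apply: filterS (filterI UB US) => x [[Mx x1 xq] /= xl].
  have xm : nsq (S x - m%:C *: x) < d.
    rewrite nsqB nsqZr x1 dotZr conjC_real ReZ -/(q x).
    have := Sqm _ Mx; move: xq; rewrite ltrBlDr -ltrBlDl ltr_pdivlMr//; nra.
  split=> //; split; first by lra.
  have -> : x - m^-1%:C *: l = m^-1%:C *: (m%:C *: x - l).
    by rewrite scalerBr scalerA -real_complexM mulVf ?gt_eqF// scale1r.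
  rewrite nsqZr exprVn mulrC ltr_pdivrMr ?exprn_gt0// mulrC.
  by have := nsqB_le dot (S x) (m%:C *: x) l; rewrite (nsqBC _ _ (S x)) (nsqBC _ l); lra.
set e := m^-1%:C *: l in eig.
exists e; split.
- apply: cM => r r0; have [x [Mx _ [_ xe]]] := filter_ex (eig _ r0).
  by exists x => //; rewrite nsqBC.
- move=> e0; have [x [_ x1 [_]]] := filter_ex (eig _ ltr01).
  by rewrite e0 subr0 x1 ltxx.
exists m; apply/subr0_eq/(nsq_eq0 (dot := dot))/eqP.
rewrite eq_le nsq_ge0 andbT; apply: (@le0_small _ _ (2 + (c *+ 2 + m ^+ 2 *+ 2) *+ 2)).
  by have := sqr_ge0 m; lra.
move=> r r0; have [x [_ _ [h1 h2]]] := filter_ex (eig _ r0).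
(* Compare [e] with a nearby approximate eigenvector [x]. *)
have -> : S e - m%:C *: e = (S x - m%:C *: x) - (S (x - e) - m%:C *: (x - e)).
  by rewrite (linearS_B lS) scalerBr subrACA !subKr.
have hB : nsq (S (x - e) - m%:C *: (x - e)) <= (c *+ 2 + m ^+ 2 *+ 2) * r.
  have := nsqB_le dot 0 (S (x - e)) (m%:C *: (x - e)).
  rewrite !subr0 nsqZr => /le_trans; apply.
  have := Sc (x - e); have := sqr_ge0 m; move: (nsq (x - e)) h2 => w; nra.
have := nsqB_le dot 0 (S x - m%:C *: x) (S (x - e) - m%:C *: (x - e)).
rewrite !subr0; lra.
Qed.

(** Take a maximal orthonormal set of eigenvectors, by Zorn. Its orthogonal complement is closed and
    stable under [S]; were it nonzero, it would contain a further eigenvector. *)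
Theorem spectral_theorem : exists E, orthonormal_basis dot E /\
  forall e, E e -> S e = (q e)%:C *: e.
Proof.
pose P (E : set H) := (forall e f, E e -> E f -> dot e f = (e == f)%:R) /\
  (forall e, E e -> exists m : R, S e = m%:C *: e).
have [F FP tF|A [[oA eA] maxA]] := @Zorn_bigcup _ P.
  split=> [e f [X FX Xe] [Y FY Yf]|e [X FX Xe]]; last exact: (FP _ FX).2.
  have [XY|YX] := tF _ _ FX FY.
    by apply: (FP _ FY).1 => //; exact: XY.
  by apply: (FP _ FX).1 => //; exact: YX.
exists A; split; last first.
  move=> e Ae; have [m Sm] := eA _ Ae.
  by rewrite /q {2}Sm dotZl oA// eqxx mulr1 Sm.
split=> // x xA; apply: contrapT => x0.
pose M := [set y | forall e, A e -> dot y e = 0].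
have sM : lin_subset M.
  split=> [e _|a y z My Mz e Ae]; first by rewrite dot0l.
  by rewrite dotDl dotZl My// Mz// mulr0 addr0.
have cM : approx_closed dot M.
  move=> y hy e Ae; apply/sqmod_eq0/eqP; rewrite eq_le sqmod_ge0 andbT.
  apply: (@le0_small _ _ 1) => // r r0; have [z Mz yz] := hy _ r0.
  have -> : dot y e = dot (y - z) e by rewrite dotDl dotNl (Mz e)// subr0.
  apply: (le_trans (cauchy_schwarz _ _ _)).
  have -> : nsq e = 1 by rewrite /nsq oA// eqxx.
  by rewrite mulr1 mul1r ltW.
have SM y : M y -> M (S y).
  by move=> My e Ae; have [m Sm] := eA _ Ae; rewrite symS Sm dotZr My// mulr0.
have [e [Me e0 [m Sm]]] := exists_eigenvector sM cM SM xA x0.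
pose k := (Num.sqrt (nsq e))^-1; pose u := k%:C *: e.
have u1 : dot u u = 1.
  rewrite dotxx nsqZr exprVn sqr_sqrtr ?nsq_ge0// mulVf// gt_eqF//.
  exact: nsq_gt0.
have Mu : M u by move=> f Af; rewrite dotZl Me// mulr0.
have uA : ~ A u by move=> /Mu; rewrite u1 => /eqP; rewrite oner_eq0.
apply: (maxA (A `|` [set u])).
  by split=> [|h]; [exact: subsetUl|apply: uA; apply: h; right].
have neu f : A f -> (u == f) = false /\ (f == u) = false.
  by move=> Af; split; apply/eqP => h; apply: uA; rewrite ?h// -h.
split=> [f g|f].
  move=> [Af|/= ->] [Ag|/= ->]; first exact: oA.
  - by rewrite (neu f Af).2 dotC Mu// rmorph0.
  - by rewrite (neu g Ag).1 Mu.
  - by rewrite eqxx.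
move=> [/eA//|/= ->]; exists m.
by rewrite /u linearS_Z// Sm !scalerA mulrC.
Qed.

End PositiveOperator.

End Spectral.

(** * Schatten norms as sums over singular bases *)

Lemma esum_exchange (R : realType) (I K : choiceType) (J : set I) (L : set K)
    (a : I -> K -> \bar R) : (forall i k, 0 <= a i k)%E ->
  (\esum_(i in J) \esum_(k in L) a i k = \esum_(k in L) \esum_(i in J) a i k)%E.
Proof.
move=> a0; rewrite !esum_esum//; apply: (@reindex_esum _ _ _ _ _ (fun z => (z.2, z.1))).
split=> [[k i] [Lk Ji]//|[k i] [k' i'] _ _ /= [-> ->]//|[i k] [/= Ji Lk]].
by exists (k, i).
Qed.

Section Schatten.
Context (R : realType) (H : completeNormedModType R[i]).
Variable dot : {dot H for Num.conj}.
Hypothesis dotP : is_inner_product dot.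
Implicit Types (x y z : H) (S T : H -> H) (E : set H).
Local Notation nsq := (nsq dot).
Local Notation bounded_linear := (bounded_linear dot).
Local Notation adj := (adjoint dot).
Local Notation ucompact := (ucompact dot).

(** Polarization: [f] vanishes on the diagonal because [dot (T x) x] is real, so it is
    antisymmetric; replacing [y] by ['i *: y] then forces [f = 0]. *)
Lemma positive_selfadjoint T : bounded_linear T -> (forall x, 0 <= dot (T x) x) ->
  forall x y, dot (T x) y = dot x (T y).
Proof.
move=> [lT _] pT.
pose f x y := dot (T x) y - dot x (T y).
have f0 x : f x x = 0.
  rewrite /f (dotC dot (T x) x); move: (pT x); rewrite lecE /=.
  case: (dot _ _) => a b /= /andP[/eqP -> _].
  by apply/eqP; rewrite eq_complex /= oppr0 !subrr !eqxx.
have fD x y : f x y + f y x = 0.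
  have e : f (x + y) (x + y) = f x x + f y y + (f x y + f y x).
    by rewrite /f (linearS_D lT) !dotDl !dotDr; ring.
  by move: e; rewrite !f0 !add0r.
move=> x y; apply/subr0_eq; rewrite -/(f x y).
have h1 := fD x y; have h2 := fD x ('i *: y).
have e1 : f x ('i *: y) = - ('i * f x y).
  by rewrite /f (linearS_Z lT) !dotZr conjCi; ring.
have e2 : f ('i *: y) x = 'i * f y x.
  by rewrite /f (linearS_Z lT) !dotZl; ring.
move: h2; rewrite e1 e2 (_ : f y x = - f x y); last by apply/eqP; rewrite -addr_eq0 addrC h1.
rewrite mulrN -opprD => /eqP; rewrite oppr_eq0 -mulr2n mulrn_eq0 /= mulf_eq0.
by rewrite (negbTE (neq0Ci _)) /= => /eqP.
Qed.

Lemma bounded_linear_ext E S T : orthonormal_basis dot E -> bounded_linear S -> bounded_linear T ->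
  (forall e, E e -> S e = T e) -> S = T.
Proof.
move=> bE [lS [c c0 Sc]] [lT [d d0 Td]] ST; apply/funext.
apply: (lin_subset_basis dotP bE (M := [set x | S x = T x])) => //.
  by split=> [|a x y /= xx yy]; rewrite /= ?(linearS_0 lS) ?(linearS_0 lT)// lS lT xx yy.
move=> x hx; apply/subr0_eq/(nsq_eq0 (dot := dot))/eqP.
rewrite eq_le nsq_ge0 andbT.
apply: (@le0_small _ _ (c *+ 2 + d *+ 2)); first by rewrite addr_ge0// mulrn_wge0// ltW.
move=> e e0; have [y /= My xy] := hx _ e0.
have -> : S x - T x = S (x - y) - T (x - y).
  by rewrite (linearS_B lS) (linearS_B lT) My subrACA subrr subr0.
have := nsqB_le dot 0 (S (x - y)) (T (x - y)); rewrite !subr0 => /le_trans; apply.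
have := Sc (x - y); have := Td (x - y); nra.
Qed.

Lemma diagonal_selfadjoint E (m : H -> R) S : orthonormal_basis dot E -> bounded_linear S ->
  (forall x e, E e -> dot (S x) e = (m e)%:C * dot x e) ->
  forall x y, dot (S x) y = dot x (S y).
Proof.
move=> bE bS hS x y; rewrite (adjointE dotP)//; congr (dot _ _).
apply: (basis_inj bE) => e Ee.
by rewrite hS// -(adjointE_r dotP)// (diagonal_eigen bE hS)// dotZr conjC_real.
Qed.

(** Right singular vectors of [T]; for a unit eigenvector [e] of [adj T \o T] the eigenvalue is
    necessarily [nsq (T e)], the square of a singular value. *)
Definition singular_basis T E := orthonormal_basis dot E /\
  forall e, E e -> adj T (T e) = (nsq (T e))%:C *: e.

Lemma singular_basis_exists T : linear T -> ucompact T ->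
  exists E, singular_basis T E.
Proof.
move=> lT cT; have bT := ucompact_bounded lT cT; have bT' := bounded_linear_adjoint dotP bT.
have [|||E [bE hE]] := @spectral_theorem _ _ _ (adj T \o T) (bounded_linear_comp bT' bT).
- exact: ucompact_compl.
- by move=> x y /=; rewrite -(adjointE_r dotP)// (adjointE dotP).
- by move=> x /=; rewrite -(adjointE_r dotP)// nsq_ge0.
exists E; split=> // e Ee; have := hE e Ee; rewrite /= => {1}->.
by rewrite -(adjointE_r dotP).
Qed.

Lemma nsq_basis E e : orthonormal_basis dot E -> E e -> nsq e = 1.
Proof. by move=> [oE _] Ee; rewrite /nsq oE// eqxx. Qed.

(** The square root is built as [Q \o Q], where [Q] is diagonal with the square roots [r e] of the
    singular values: positivity then reads [0 <= dot (Q x) (Q x)]. *)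
Lemma modulus_exists T : linear T -> ucompact T ->
  positive_operator dot (modulus dot T) /\
  modulus dot T \o modulus dot T = adj T \o T.
Proof.
move=> lT cT; have bT := ucompact_bounded lT cT; have bT' := bounded_linear_adjoint dotP bT.
have [E [bE hE]] := singular_basis_exists lT cT.
have [c c0 Tc] := bT.2.
apply: (@xgetPex _ (fun=> 0) [set S | positive_operator dot S /\ S \o S = adj T \o T]).
pose r e := Num.sqrt (Num.sqrt (nsq (T e))).
have [Q [bQ hQ]] : exists S, bounded_linear S /\
    (forall x e, E e -> dot (S x) e = (r e)%:C * dot x e).
  apply: (diagonal_operator dotP bE (c := Num.sqrt (Num.sqrt c))) => e Ee.
  rewrite sqrtr_ge0 /= !ler_wsqrtr//; apply: (le_trans (Tc e)).
  by rewrite (nsq_basis bE Ee) mulr1.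
have sQ := diagonal_selfadjoint bE bQ hQ.
exists (Q \o Q); split; first split.
- by apply/(bounded_operatorP dotP)/bounded_linear_comp.
- by move=> x /=; rewrite sQ; exact: dnorm_ge0.
apply/funext => x; apply: (basis_inj bE) => e Ee /=.
rewrite !hQ// !mulrA -!real_complexM.
rewrite -(adjointE_r dotP)// (adjointE dotP)// hE// dotZr conjC_real; congr (_%:C * _).
have <- : r e ^+ 4 = nsq (T e) by rewrite (exprM _ 2 2) !sqr_sqrtr ?sqrtr_ge0 ?nsq_ge0.
by ring.
Qed.

End Schatten.

Section SchattenNorm.
Context (R : realType) (H : completeNormedModType R[i]).
Variable dot : {dot H for Num.conj}.
Hypothesis dotP : is_inner_product dot.
Implicit Types (x y z : H) (S T : H -> H) (E : set H).
Local Notation nsq := (nsq dot).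
Local Notation bounded_linear := (bounded_linear dot).
Local Notation adj := (adjoint dot).
Local Notation ucompact := (ucompact dot).
Local Notation singular_basis := (singular_basis dot).

(** Both sides are the double sum of [sqmod (dot (T e) f)], by Parseval. *)
Lemma esum_nsq_adjoint E F T : orthonormal_basis dot E -> orthonormal_basis dot F ->
  bounded_linear T ->
  (\esum_(e in E) (nsq (T e))%:E = \esum_(f in F) (nsq (adj T f))%:E)%E.
Proof.
move=> bE bF bT.
under eq_esum => e _ do rewrite -(parseval dotP (T e) bF).
under [RHS]eq_esum => f _ do rewrite -(parseval dotP (adj T f) bE).
rewrite esum_exchange; last by move=> *; rewrite lee_fin sqmod_ge0.
apply: eq_esum => f _; apply: eq_esum => e _.
by rewrite (adjointE dotP)// (dotC dot (adj T f)) sqmodJ.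
Qed.

(** With [S = Q \o Q] and [Q] self-adjoint, the trace is the sum of [nsq (Q e)], which
    [esum_nsq_adjoint] shows to be independent of the basis. *)
Lemma trace_diagonal E (m : H -> R) S : orthonormal_basis dot E -> bounded_linear S ->
  (forall e, E e -> 0 <= m e) -> (forall e, E e -> S e = (m e)%:C *: e) ->
  trace dot S = (\esum_(e in E) (m e)%:E)%E.
Proof.
move=> bE bS m0 hS; rewrite /trace; set G := xget _ _.
have bG : orthonormal_basis dot G by apply: (@xgetPex _ set0); exists E.
have [c c0 Sc] := bS.2.
have mS e : E e -> m e ^+ 2 = nsq (S e).
  by move=> Ee; rewrite hS// nsqZr (nsq_basis bE Ee) mulr1.
pose r e := Num.sqrt (m e).
have [Q [bQ hQ]] : exists S, bounded_linear S /\
    (forall x e, E e -> dot (S x) e = (r e)%:C * dot x e).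
  apply: (diagonal_operator dotP bE (c := Num.sqrt (Num.sqrt c))) => e Ee.
  rewrite sqrtr_ge0 /= ler_wsqrtr// -[leLHS]ger0_norm ?m0// -sqrtr_sqr.
  by rewrite ler_wsqrtr// mS// (le_trans (Sc e))// (nsq_basis bE Ee) mulr1.
have sQ := diagonal_selfadjoint dotP bE bQ hQ.
have rr e : E e -> (r e)%:C * (r e)%:C = (m e)%:C.
  by move=> Ee; rewrite -real_complexM -expr2 sqr_sqrtr ?m0.
have -> : S = Q \o Q.
  apply: (bounded_linear_ext dotP bE) => //; first exact: bounded_linear_comp.
  move=> e Ee /=; apply: (basis_inj bE) => f Ef.
  rewrite !hQ// mulrA rr// hS// dotZl (basis_orthonormal bE)//=.
  by case: eqP => [->//|_]; rewrite !mulr0.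
have aQ : adj Q = Q by exact: adjoint_unique.
transitivity (\esum_(e in G) (nsq (Q e))%:E)%E.
  by apply: eq_esum => e _; rewrite /= sQ.
rewrite (esum_nsq_adjoint bG bE bQ) aQ; apply: eq_esum => e Ee.
rewrite (diagonal_eigen bE hQ)// nsqZr (nsq_basis bE Ee) mulr1.
by rewrite sqr_sqrtr ?m0.
Qed.

(** On a singular basis this sums the singular values to the power [2 * q]; Schatten norms use
    [q = p / 2]. *)
Definition power_sum q T E : \bar R := \esum_(e in E) (nsq (T e) `^ q)%:E.

(** The basis is the one behind the chosen value of [operator_pow]; diagonalizing the modulus, it
    also diagonalizes [adj T \o T]. *)
Lemma schatten_normE (p : R) T : 0 < p -> linear T -> ucompact T ->
  exists2 E, singular_basis T E &
    (schatten_norm dot p T = power_sum (p / 2) T E `^ p^-1)%E.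
Proof.
move=> p0 lT cT; have bT := ucompact_bounded lT cT.
have [[pM1 pM] MM] := modulus_exists dotP lT cT.
move: pM1 => /(bounded_operatorP dotP) bM.
rewrite /schatten_norm; set M := modulus dot T in bM pM MM *.
have sM := positive_selfadjoint bM pM.
have bT' := bounded_linear_adjoint dotP bT.
have MME x : M (M x) = adj T (T x) := congr1 (fun f => f x) MM.
have nM x : nsq (M x) = nsq (T x).
  by rewrite /nsq -sM MME -(adjointE_r dotP).
have cM : ucompact M.
  apply: (@ucompact_dominated _ _ _ dotP M (adj T \o T)) => [|||x /=].
  - exact: bM.1.
  - exact: (bounded_linear_comp bT' bT).1.
  - exact: ucompact_compl.
  by rewrite -MME -sqmod_real -dotxx -sM; exact: cauchy_schwarz.
have [E [bE hE]] := spectral_theorem bM cM sM (fun x => Re_ge0 (pM x)).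
pose m e := complex.Re (dot (M e) e).
have m0 e : 0 <= m e by exact: Re_ge0.
have mT e : E e -> m e = Num.sqrt (nsq (T e)).
  move=> Ee; rewrite -nM hE// nsqZr (nsq_basis bE Ee) mulr1 sqrtr_sqr ger0_norm//.
  exact: m0.
set P := operator_pow dot M p.
have [c c0 Tc] := bT.2.
have [bP [F bF hF]] : bounded_operator P /\ exists2 E, orthonormal_basis dot E &
    forall e, E e -> exists l : R,
      M e = l%:C *: e /\ P e = (l `^ p)%:C *: e.
  apply: (@xgetPex _ (fun=> 0) [set S | bounded_operator S /\ exists2 E, orthonormal_basis dot E &
    forall e, E e -> exists l : R,
      M e = l%:C *: e /\ S e = (l `^ p)%:C *: e]).
  (* The spectral theorem for the modulus supplies a candidate, so [xget] does not return its
     default. *)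
  have [Q [bQ hQ]] : exists S, bounded_linear S /\
      (forall x e, E e -> dot (S x) e = (m e `^ p)%:C * dot x e).
    apply: (diagonal_operator dotP bE (c := Num.sqrt c `^ p)) => e Ee.
    have mc : m e <= Num.sqrt c.
      rewrite mT// ler_wsqrtr// (le_trans (Tc e))// (nsq_basis bE Ee) mulr1//.
    rewrite powR_ge0 /=; apply: ge0_ler_powR => //; first exact: ltW.
      by rewrite nnegrE.
    by rewrite nnegrE sqrtr_ge0.
  exists Q; split; first exact/(bounded_operatorP dotP).
  exists E => // e Ee; exists (m e); split; first exact: hE.
  exact: (diagonal_eigen bE hQ).
have key e : F e -> adj T (T e) = (nsq (T e))%:C *: e /\
    P e = (nsq (T e) `^ (p / 2))%:C *: e.
  move=> Fe; have [l [Ml Pl]] := hF e Fe.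
  (* The sign is needed to read [(l ^+ 2)]^ (p / 2)[as]l [^ p]. *)
  have l0 : 0 <= l.
    have := m0 e; rewrite /m Ml dotZl ReZ -/(nsq e).
    by rewrite (nsq_basis bF Fe) mulr1.
  have l2 : nsq (T e) = l ^+ 2.
    by rewrite -nM Ml nsqZr (nsq_basis bF Fe) mulr1.
  rewrite -MME Ml (linearS_Z bM.1) Ml scalerA -real_complexM -expr2 l2; split=> //.
  by rewrite -powR_mulrn// -powRrM mulrCA divff ?mulr1.
exists F; first by split=> // e /key[].
congr (_ `^ _)%E; apply: (trace_diagonal bF); first exact/(bounded_operatorP dotP).
  by move=> e _; exact: powR_ge0.
by move=> e /key[].
Qed.

End SchattenNorm.

(** * Jensen inequalities for weighted sums *)

Section PowerInequalities.
Context (R : realType).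
Implicit Types (a b c q : R).

(** The graph of the [q]-th power lies above its tangent at [c]: Young's inequality with exponents
    [q] and [q / (q - 1)]. *)
Lemma powR_tangent_convex q a c : 1 <= q -> 0 <= a -> 0 <= c ->
  q * c `^ (q - 1) * a <= a `^ q + (q - 1) * c `^ q.
Proof.
move=> q1 a0 c0; have q0 : 0 < q by rewrite (lt_le_trans ltr01).
have [->|qn1] := eqVneq q 1.
  by rewrite subrr powRr0 mul0r addr0 !mul1r powRr1.
have q1' : 0 < q - 1 by rewrite subr_gt0 lt_def qn1.
have := @conjugate_powR _ a (c `^ (q - 1)) q (q / (q - 1)) a0 (powR_ge0 _ _) q0.
rewrite -powRrM [(q - 1) * _]mulrC divfK ?gt_eqF// invf_div => h.
have {}h := h (divr_gt0 q0 q1').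
have -> : q * c `^ (q - 1) * a = q * (a * c `^ (q - 1)) by ring.
have -> : a `^ q + (q - 1) * c `^ q = q * (a `^ q / q + c `^ q * ((q - 1) / q)).
  by field; rewrite gt_eqF.
rewrite ler_pM2l//; apply: h; field; rewrite gt_eqF//.
Qed.

Lemma powR_tangent_concave q a c : 0 < q <= 1 -> 0 <= a -> 0 <= c ->
  a `^ q * c `^ (1 - q) <= q * a + (1 - q) * c.
Proof.
move=> /andP[q0 q1] a0 c0; have [->|qn1] := eqVneq q 1.
  by rewrite subrr powRr0 mul0r addr0 mulr1 mul1r powRr1.
have q1' : 0 < 1 - q by rewrite subr_gt0 lt_def eq_sym qn1.
have := @conjugate_powR _ (a `^ q) (c `^ (1 - q)) q^-1 (1 - q)^-1
  (powR_ge0 _ _) (powR_ge0 _ _).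
rewrite -!powRrM !divff ?gt_eqF// !powRr1// !invr_gt0 !invrK [a * q]mulrC [c * _]mulrC.
by apply=> //; ring.
Qed.

Lemma powR_mid_convex q a b : 1 <= q -> 0 <= a -> 0 <= b ->
  ((a + b) / 2) `^ q <= (a `^ q + b `^ q) / 2.
Proof.
move=> q1 a0 b0; have c0 : 0 <= (a + b) / 2 by rewrite divr_ge0// addr_ge0.
have ha := powR_tangent_convex q1 a0 c0; have hb := powR_tangent_convex q1 b0 c0.
set c := (a + b) / 2 in ha hb c0 *.
have h : c * c `^ (q - 1) = c `^ q.
  by apply: mulr_powRB1 => //; exact: lt_le_trans q1.
have ab : a + b = c * 2 by rewrite /c divfK.
have : q * c `^ (q - 1) * a + q * c `^ (q - 1) * b = 2 * q * c `^ q.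
  by rewrite -mulrDr ab -h; ring.
lra.
Qed.

Lemma powR_mid_concave q a b : 0 < q <= 1 -> 0 <= a -> 0 <= b ->
  (a `^ q + b `^ q) / 2 <= ((a + b) / 2) `^ q.
Proof.
move=> q01 a0 b0; have /andP[q0 q1] := q01.
have c0 : 0 <= (a + b) / 2 by rewrite divr_ge0// addr_ge0.
have ha := powR_tangent_concave q01 a0 c0; have hb := powR_tangent_concave q01 b0 c0.
have [ab0|abn0] := eqVneq (a + b) 0.
  have -> : a = 0 by lra.
  have -> : b = 0 by lra.
  by rewrite !addr0 mul0r powR0 ?gt_eqF// addr0 mul0r.
set c := (a + b) / 2 in ha hb c0 *.
have cp : 0 < c by rewrite lt_def c0 andbT mulf_neq0// invr_eq0 pnatr_eq0.
have ab : a + b = c * 2 by rewrite /c divfK.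
have h : c `^ q * c `^ (1 - q) = c.
  by rewrite -powRD ?(gt_eqF cp) ?implybT// (_ : q + (1 - q) = 1)%R ?powRr1 //; ring.
have dp : 0 < c `^ (1 - q) by rewrite powR_gt0.
have qab : q * a + q * b = q * c * 2 by rewrite -mulrDr ab mulrA.
rewrite -(ler_pM2r dp) h; lra.
Qed.

End PowerInequalities.

Section DoubleSums.
Context (R : realType).
Local Open Scope ereal_scope.

Lemma esumZl (I : choiceType) (J : set I) (c : R) (a : I -> R) : (0 <= c)%R ->
  (forall i, J i -> (0 <= a i)%R) ->
  \esum_(i in J) (c * a i)%:E = c%:E * \esum_(i in J) (a i)%:E.
Proof.
move=> c0 a0; have [->|cn0] := eqVneq c 0%R.
  by rewrite mul0e esum1// => i _; rewrite mul0r.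
have cp : (0 < c)%R by rewrite lt_def cn0.
have half (d : R) (b : I -> R) : (0 < d)%R -> 
    \esum_(i in J) (d * b i)%:E <= d%:E * \esum_(i in J) (b i)%:E.
  move=> d0; apply: esum_le_seq => s us sJ.
  by rewrite -mulr_sumr EFinM lee_pmul2l//; exact: esum_ge_seq.
apply/eqP; rewrite eq_le half//=.
have ci : (0 < c^-1)%R by rewrite invr_gt0.
rewrite -(@lee_pmul2l _ (c^-1)%:E)// muleA -EFinM mulVf// mul1e.
have := half _ (fun i => (c * a i)%R) ci.
by under eq_esum do rewrite mulrA mulVf// mul1r.
Qed.

Lemma half_doubleE (N : \bar R) : 0 <= N -> 2^-1%:E * (N + N) = N.
Proof.
move=> N0; rewrite ge0_muleDr// -ge0_muleDl ?lee_fin//.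
by rewrite -EFinD (_ : 2^-1 + 2^-1 = 1 :> R)%R ?mul1e//; lra.
Qed.

Section Jensen.
Context (K : choiceType) (L : set K) (w l : K -> R) (t : R).
Hypotheses (w0 : forall k, (0 <= w k)%R) (l0 : forall k, L k -> (0 <= l k)%R)
  (t0 : (0 <= t)%R) (w1 : \esum_(k in L) (w k)%:E <= 1).

Lemma jensen_convex q : (1 <= q)%R ->
  t%:E <= \esum_(k in L) (w k * l k)%:E ->
  (t `^ q)%:E <= \esum_(k in L) (w k * l k `^ q)%:E.
Proof.
move=> q1 ht; have q0 : (0 < q)%R by rewrite (lt_le_trans ltr01).
have qt0 : (0 <= q * t `^ (q - 1))%R by rewrite mulr_ge0 ?powR_ge0 ?ltW.
have qm : (0 <= (q - 1) * t `^ q)%R by rewrite mulr_ge0 ?powR_ge0 ?subr_ge0.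
have h : (q * t `^ (q - 1))%:E * t%:E <=
    \esum_(k in L) (w k * l k `^ q)%:E + ((q - 1) * t `^ q)%:E.
  apply: (@le_trans _ _ ((q * t `^ (q - 1))%:E * \esum_(k in L) (w k * l k)%:E)).
    by rewrite lee_wpmul2l// lee_fin.
  rewrite -esumZl//; last by move=> k Lk; rewrite mulr_ge0// l0.
  apply: (@le_trans _ _ (\esum_(k in L) ((w k * l k `^ q)%:E + ((q - 1) * t `^ q * w k)%:E))).
    apply: le_esum => k Lk; rewrite -EFinD lee_fin.
    have := powR_tangent_convex q1 (l0 Lk) t0.
    move=> /(ler_wpM2l (w0 k)); lra.
  rewrite esumD; [|by move=> *; rewrite lee_fin mulr_ge0// powR_ge0
    |by move=> *; rewrite lee_fin mulr_ge0].
  rewrite leeD2l// esumZl//.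
  by rewrite -[leRHS]mule1 lee_wpmul2l// lee_fin.
rewrite -EFinM in h.
have e : (q * t `^ (q - 1) * t = t `^ q + (q - 1) * t `^ q)%R.
  by rewrite -(mulr_powRB1 t0 q0); ring.
by move: h; rewrite e EFinD leeD2rE.
Qed.

Lemma jensen_concave q : (0 < q <= 1)%R ->
  \esum_(k in L) (w k * l k)%:E <= t%:E ->
  \esum_(k in L) (w k * l k `^ q)%:E <= (t `^ q)%:E.
Proof.
move=> q01 ht; have /andP[q0 q1] := q01.
have [tz|tn0] := eqVneq t 0%R.
  rewrite tz in ht *; rewrite powR0 ?gt_eqF// esum1// => k Lk.
  have : (w k * l k)%:E <= 0.
    apply: le_trans ht; have := @esum_ge_seq _ _ L (fun k => w k * l k)%R [:: k] isT.
    by rewrite big_seq1; apply => i; rewrite inE => /eqP ->.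
  rewrite lee_fin => h; have : (w k * l k == 0)%R.
    by rewrite eq_le h mulr_ge0// l0.
  rewrite mulf_eq0 => /orP[/eqP->|/eqP->]; first by rewrite mul0r.
  by rewrite powR0 ?mulr0// gt_eqF.
have tp : (0 < t)%R by rewrite lt_def tn0.
have dp : (0 < t `^ (1 - q))%R by rewrite powR_gt0.
have h : (t `^ q * t `^ (1 - q))%R = t.
  by rewrite -powRD ?(gt_eqF tp) ?implybT// (_ : q + (1 - q) = 1)%R ?powRr1 //; ring.
rewrite -(@lee_pmul2l _ (t `^ (1 - q))%:E)// -EFinM [(_ * t `^ q)%R]mulrC h.
rewrite -esumZl; [|exact: ltW|by move=> k _; rewrite mulr_ge0// powR_ge0].
apply: (@le_trans _ _ (\esum_(k in L) ((q * (w k * l k))%:E + ((1 - q) * t * w k)%:E))).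
  apply: le_esum => k Lk; rewrite -EFinD lee_fin.
  have := powR_tangent_concave q01 (l0 Lk) t0.
  move=> /(ler_wpM2l (w0 k)); lra.
have qt : (0 <= (1 - q) * t)%R by rewrite mulr_ge0// subr_ge0.
rewrite esumD; last 2 first.
- move=> k Lk; rewrite lee_fin; apply: mulr_ge0; first exact: ltW.
  by apply: mulr_ge0 => //; exact: l0.
- by move=> *; rewrite lee_fin mulr_ge0.
rewrite !esumZl//; [|exact: ltW|by move=> k Lk; apply: mulr_ge0 => //; exact: l0].
have -> : t%:E = q%:E * t%:E + ((1 - q) * t)%:E * 1.
  by rewrite mule1 -EFinM -EFinD; congr _%:E; ring.
by apply: leeD; apply: lee_wpmul2l => //; rewrite lee_fin ltW.
Qed.

End Jensen.

Section Double.
Context (I K : choiceType) (J : set I) (L : set K) (w : I -> K -> R)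
  (l : K -> R) (t : I -> R).
Hypotheses (w0 : forall i k, (0 <= w i k)%R) (l0 : forall k, L k -> (0 <= l k)%R)
  (t0 : forall i, J i -> (0 <= t i)%R)
  (w1 : forall i, J i -> \esum_(k in L) (w i k)%:E <= 1).

(** Jensen in each row, exchange of the sums, then the bound on the columns. *)
Lemma double_convex q : (1 <= q)%R ->
  (forall k, L k -> \esum_(i in J) (w i k)%:E <= 1) ->
  (forall i, J i -> (t i)%:E <= \esum_(k in L) (w i k * l k)%:E) ->
  \esum_(i in J) (t i `^ q)%:E <= \esum_(k in L) (l k `^ q)%:E.
Proof.
move=> q1 w1' tl.
apply: (@le_trans _ _ (\esum_(i in J) \esum_(k in L) (w i k * l k `^ q)%:E)).
  by apply: le_esum => i Ji; apply: jensen_convex => //; [exact: t0|exact: w1|exact: tl].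
rewrite esum_exchange; last by move=> i k; rewrite lee_fin mulr_ge0// powR_ge0.
apply: le_esum => k Lk; under eq_esum do rewrite mulrC.
rewrite esumZl ?powR_ge0// -[leRHS]mule1.
by apply: lee_wpmul2l; [rewrite lee_fin powR_ge0|exact: w1'].
Qed.

Lemma double_concave q : (0 < q <= 1)%R ->
  (forall k, L k -> (0 < l k)%R -> 1 <= \esum_(i in J) (w i k)%:E) ->
  (forall i, J i -> \esum_(k in L) (w i k * l k)%:E <= (t i)%:E) ->
  \esum_(k in L) (l k `^ q)%:E <= \esum_(i in J) (t i `^ q)%:E.
Proof.
move=> q01 w1' tl; have /andP[q0 _] := q01.
apply: (@le_trans _ _ (\esum_(i in J) \esum_(k in L) (w i k * l k `^ q)%:E)); last first.
  by apply: le_esum => i Ji; apply: jensen_concave => //; [exact: t0|exact: w1|exact: tl].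
rewrite esum_exchange; last by move=> i k; rewrite lee_fin mulr_ge0// powR_ge0.
apply: le_esum => k Lk; under [leRHS]eq_esum do rewrite mulrC.
rewrite esumZl ?powR_ge0//.
have [lz|ln0] := eqVneq (l k) 0%R; first by rewrite lz powR0 ?gt_eqF// mul0e.
rewrite -[leLHS]mule1; apply: lee_wpmul2l; first by rewrite lee_fin powR_ge0.
by apply: w1' => //; rewrite lt_def ln0 l0.
Qed.

End Double.

End DoubleSums.

(** * Majorization *)

Section Majorization.
Context (R : realType) (H : completeNormedModType R[i]).
Variable dot : {dot H for Num.conj}.
Hypothesis dotP : is_inner_product dot.
Implicit Types (x y z : H) (S T : H -> H) (E : set H).
Local Notation nsq := (nsq dot).
Local Notation bounded_linear := (bounded_linear dot).
Local Notation adj := (adjoint dot).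
Local Notation ucompact := (ucompact dot).
Local Notation singular_basis := (singular_basis dot).
Local Notation onb := (orthonormal_basis dot).
Local Notation power_sum := (power_sum dot).

Lemma linearS_sum (I : Type) (s : seq I) (c : I -> R[i]) (v : I -> H) T :
  linear T -> T (\sum_(i <- s) c i *: v i) = \sum_(i <- s) c i *: T (v i).
Proof.
move=> lT; elim: s => [|i s IH]; first by rewrite !big_nil linearS_0.
by rewrite !big_cons (linearS_D lT) (linearS_Z lT) IH.
Qed.

Section Frame.
Context (I : choiceType) (J : set I) (w : I -> H) (E : set H) (S : H -> H)
  (l : H -> R).
Hypotheses (bE : onb E) (lS : linear S)
  (hl : forall e, E e -> S e = (l e)%:C *: e)
  (frame : forall x, \esum_(i in J) (sqmod (dot x (w i)))%:E
                     = (complex.Re (dot (S x) x))%:E).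

(* [E] diagonalizes [S] and [S] is the sum of the rank-one operators
   [<., w i> w i]; these weights write [nsq (w i)] as averages of the
   eigenvalues, where [l e = 0] gives the weight [0]. *)
Let weight i e : R := sqmod (dot e (w i)) / l e.

Let l_quad e : E e -> l e = complex.Re (dot (S e) e).
Proof. by move=> Ee; rewrite hl// dotZl dotxx (nsq_basis bE Ee) mulr1. Qed.

Let sum_weight_r e : E e ->
  (\esum_(i in J) (sqmod (dot e (w i)))%:E = (l e)%:E)%E.
Proof. by move=> Ee; rewrite frame l_quad. Qed.

Let l_ge0 e : E e -> 0 <= l e.
Proof.
move=> Ee; rewrite -lee_fin -sum_weight_r//; apply: esum_ge0 => i _.
by rewrite lee_fin sqmod_ge0.
Qed.

Let weight_ge0 i e : E e -> 0 <= weight i e.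
Proof. by move=> Ee; rewrite divr_ge0 ?sqmod_ge0 ?l_ge0. Qed.

Let coef_le i x : J i -> sqmod (dot x (w i)) <= complex.Re (dot (S x) x).
Proof.
move=> Ji; rewrite -lee_fin -frame.
have := @esum_ge_seq _ _ J (fun i => sqmod (dot x (w i))) [:: i] isT.
by rewrite big_seq1; apply => j; rewrite inE => /eqP ->.
Qed.

(** If [l e = 0], the frame identity at [e] makes every coefficient [dot e (w i)] vanish, in
    agreement with division by zero. *)
Let weightM i e : J i -> E e -> weight i e * l e = sqmod (dot e (w i)).
Proof.
move=> Ji Ee; rewrite /weight; have [l0|ln0] := eqVneq (l e) 0; last by rewrite divfK.
rewrite l0 mulr0; apply/esym/eqP; rewrite eq_le sqmod_ge0 andbT.
by have := coef_le e Ji; rewrite -l_quad// l0.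
Qed.

Let weight_row i : J i -> (\esum_(e in E) (weight i e * l e)%:E = (nsq (w i))%:E)%E.
Proof.
move=> Ji; rewrite -(parseval dotP (w i) bE); apply: eq_esum => e Ee.
by rewrite weightM// dotC sqmodJ.
Qed.

(** For a finite partial sum [a], the test vector [x] satisfies both [dot x (w i) = a] and
    [dot (S x) x = a]; then [coef_le] reads [a ^+ 2 <= a]. *)
Let weight_row_le1 i : J i -> (\esum_(e in E) (weight i e)%:E <= 1)%E.
Proof.
move=> Ji; apply: esum_le_seq => s us sE; rewrite lee_fin.
set a := \sum_(e <- s) _.
pose c e := dot (w i) e / (l e)%:C.
pose x := \sum_(e <- s) c e *: e.
have a0 : 0 <= a.
  by rewrite /a big_seq sumr_ge0// => e /sE; exact: weight_ge0.
have xw : dot x (w i) = a%:C.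
  rewrite /x dot_suml /a rmorph_sum /=; apply: eq_bigr => e _.
  rewrite /c /weight mulrAC (dotC dot (w i)) mul_conjC.
  by rewrite rmorphM /= fmorphV /= -sqmodJ -dotC.
have xx : complex.Re (dot (S x) x) = a.
  rewrite /x (linearS_sum _ _ _ lS) dot_suml Re_sum /a big_seq [RHS]big_seq.
  apply: eq_bigr => e es; have Ee := sE _ es.
  rewrite hl// dotZl (dotC dot (\sum_(e <- s) c e *: e)).
  rewrite (dot_comb (basis_orthonormal bE))// es.
  rewrite mulrCA mul_conjC -real_complexM /= /c /weight sqmodM.
  rewrite -fmorphV /= sqmod_real (dotC dot e) sqmodJ.
  by have [->|ln0] := eqVneq (l e) 0; [rewrite invr0 mul0r mulr0|field].
have := coef_le x Ji; rewrite xw xx sqmod_real => aa.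
rewrite leNgt; apply/negP => a1; nra.
Qed.

Lemma frame_convex q : 1 <= q ->
  (\esum_(i in J) (nsq (w i) `^ q)%:E <= \esum_(e in E) (l e `^ q)%:E)%E.
Proof.
move=> q1.
(* Weights are extended by 0 outside [E], since [double_convex] asks for nonnegativity at every
   index. *)
have w0 i e : 0 <= (if e \in E then weight i e else 0).
  by case: ifPn => // /set_mem; exact: weight_ge0.
apply: (double_convex (w := fun i e => if e \in E then weight i e else 0)) => //.
- by move=> i _; exact: nsq_ge0.
- move=> i Ji; under eq_esum => e Ee do rewrite (mem_set Ee).
  exact: weight_row_le1.
- move=> e Ee; rewrite (mem_set Ee) /weight.
  under eq_esum do rewrite mulrC.
  rewrite esumZl; [|by rewrite invr_ge0 l_ge0|by move=> *; exact: sqmod_ge0].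
  rewrite sum_weight_r// -EFinM lee_fin.
  by have [->|ln0] := eqVneq (l e) 0; [rewrite mulr0|rewrite mulVf].
- move=> i Ji; under eq_esum => e Ee do rewrite (mem_set Ee).
  by rewrite weight_row.
Qed.

Lemma frame_concave q : 0 < q <= 1 ->
  (\esum_(e in E) (l e `^ q)%:E <= \esum_(i in J) (nsq (w i) `^ q)%:E)%E.
Proof.
move=> q01.
have w0 i e : 0 <= (if e \in E then weight i e else 0).
  by case: ifPn => // /set_mem; exact: weight_ge0.
apply: (double_concave (w := fun i e => if e \in E then weight i e else 0)) => //.
- by move=> i _; exact: nsq_ge0.
- move=> i Ji; under eq_esum => e Ee do rewrite (mem_set Ee).
  exact: weight_row_le1.
- move=> e Ee lp; rewrite (mem_set Ee) /weight.
  under eq_esum do rewrite mulrC.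
  rewrite esumZl; [|by rewrite invr_ge0 l_ge0|by move=> *; exact: sqmod_ge0].
  by rewrite sum_weight_r// -EFinM mulVf// gt_eqF.
- move=> i Ji; under eq_esum => e Ee do rewrite (mem_set Ee).
  by rewrite weight_row.
Qed.

End Frame.

Lemma parseval_adjoint E T x : onb E -> bounded_linear T ->
  (\esum_(e in E) (sqmod (dot x (T e)))%:E = (nsq (adj T x))%:E)%E.
Proof.
move=> bE bT; rewrite -(parseval dotP _ bE); apply: eq_esum => e _.
by rewrite (adjointE_r dotP).
Qed.

Section OneOperator.
Context (T : H -> H) (bT : bounded_linear T) (F G : set H).
Hypotheses (sF : singular_basis (adj T) F) (bG : onb G).

Let diag f : F f -> (T \o adj T) f = (nsq (adj T f))%:C *: f.
Proof. by move=> Ff; have := sF.2 f Ff; rewrite (adjointK dotP). Qed.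

Let quad x : (\esum_(g in G) (sqmod (dot x (T g)))%:E
  = (complex.Re (dot ((T \o adj T) x) x))%:E)%E.
Proof. by rewrite parseval_adjoint//= (adjointE dotP). Qed.

(** The frame is [T g] for [g] in [G], and [S] is [T \o adj T], diagonal in [F]. *)
Lemma power_sum_adjoint_convex q : 1 <= q ->
  (power_sum q T G <= power_sum q (adj T) F)%E.
Proof.
move=> q1; apply: (frame_convex sF.1 _ diag quad q1).
exact: (bounded_linear_comp bT (bounded_linear_adjoint dotP bT)).1.
Qed.

Lemma power_sum_adjoint_concave q : 0 < q <= 1 ->
  (power_sum q (adj T) F <= power_sum q T G)%E.
Proof.
move=> q01; apply: (frame_concave sF.1 _ diag quad q01).
exact: (bounded_linear_comp bT (bounded_linear_adjoint dotP bT)).1.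
Qed.

End OneOperator.

(** [T] and its adjoint have the same singular values: the comparison with an arbitrary basis is
    used for [T] and for [adj T]. *)
Lemma power_sum_adjoint q T E F : bounded_linear T -> 0 < q ->
  singular_basis T E -> singular_basis (adj T) F ->
  power_sum q T E = power_sum q (adj T) F.
Proof.
move=> bT q0 sE sF; have bT' := bounded_linear_adjoint dotP bT.
have sE' : singular_basis (adj (adj T)) E by rewrite (adjointK dotP).
apply/eqP; rewrite eq_le; have [q1|q1] := leP 1 q.
  rewrite (power_sum_adjoint_convex bT sF sE.1 q1)/=.
  by have := power_sum_adjoint_convex bT' sE' sF.1 q1; rewrite (adjointK dotP).
have q01 : 0 < q <= 1 by rewrite q0 ltW.
rewrite (power_sum_adjoint_concave bT sF sE.1 q01) andbT.
by have := power_sum_adjoint_concave bT' sE' sF.1 q01; rewrite (adjointK dotP).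
Qed.

(** A boolean tag merges two families into one, so that a pair of operators yields a single
    frame. *)
Lemma esum_bool (I : choiceType) (J : bool -> set I) (a : bool -> I -> R) :
  (forall b i, 0 <= a b i) ->
  (\esum_(k in [set: bool] `*`` J) (a k.1 k.2)%:E
   = \esum_(i in J true) (a true i)%:E + \esum_(i in J false) (a false i)%:E)%E.
Proof.
move=> a0.
rewrite -(@esum_esum _ _ _ [set: bool] J (fun b i => (a b i)%:E)); last first.
  by move=> b i _ _; rewrite lee_fin.
have a0' b : (0 <= \esum_(i in J b) (a b i)%:E)%E.
  by apply: esum_ge0 => i _; rewrite lee_fin.
rewrite (esumID [set true])// setTI; congr (_ + _)%E; first by rewrite esum_set1.
rewrite (_ : _ `&` _ = [set false]) ?esum_set1//.
by apply/seteqP; split=> [[] [_]|[]]//=.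
Qed.

Section TwoOperators.
Context (X Y : H -> H) (bX : bounded_linear X) (bY : bounded_linear Y) (E F D : set H) (S : H -> H)
  (l : H -> R).
Hypotheses (bE : onb E) (bF : onb F) (bD : onb D) (lS : linear S)
  (hl : forall e, D e -> S e = (l e)%:C *: e)
  (quad : forall x, complex.Re (dot (S x) x) = nsq (adj X x) + nsq (adj Y x)).

Let J b := if b then E else F.
Let v (k : bool * H) := if k.1 then X k.2 else Y k.2.

Let frame x : (\esum_(k in [set: bool] `*`` J) (sqmod (dot x (v k)))%:E
  = (complex.Re (dot (S x) x))%:E)%E.
Proof.
rewrite (@esum_bool _ J (fun b i => sqmod (dot x (v (b, i))))); last first.
  by move=> *; exact: sqmod_ge0.
by rewrite /J /v /= !parseval_adjoint// quad EFinD.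
Qed.

Let sum_v q : (\esum_(k in [set: bool] `*`` J) (nsq (v k) `^ q)%:E
  = power_sum q X E + power_sum q Y F)%E.
Proof.
by rewrite (@esum_bool _ J (fun b i => nsq (v (b, i)) `^ q))// => *; exact: powR_ge0.
Qed.

(** The frame consists of all [X e] and all [Y f]; [S] has the quadratic form of [X \o adj X] plus
    [Y \o adj Y]. *)
Lemma power_sum2_convex q : 1 <= q ->
  (power_sum q X E + power_sum q Y F <= \esum_(d in D) (l d `^ q)%:E)%E.
Proof. by move=> q1; rewrite -sum_v; exact: (frame_convex bD lS hl frame). Qed.

Lemma power_sum2_concave q : 0 < q <= 1 ->
  (\esum_(d in D) (l d `^ q)%:E <= power_sum q X E + power_sum q Y F)%E.
Proof. by move=> q1; rewrite -sum_v; exact: (frame_concave bD lS hl frame). Qed.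

End TwoOperators.

End Majorization.

(** * Real parts *)

Section ComplexAbs.
Context (R : realType).
Implicit Types z w : R[i].

Definition cmod z : R := Num.sqrt (sqmod z).

Lemma cmod_ge0 z : 0 <= cmod z.
Proof. exact: sqrtr_ge0. Qed.

Lemma cmodM z w : cmod (z * w) = cmod z * cmod w.
Proof. by rewrite /cmod sqmodM sqrtrM ?sqmod_ge0. Qed.

Lemma cmodJ z : cmod (Num.conj z) = cmod z.
Proof. by rewrite /cmod sqmodJ. Qed.

Lemma cmodr (a : R) : 0 <= a -> cmod a%:C = a.
Proof. by move=> a0; rewrite /cmod sqmod_real sqrtr_sqr ger0_norm. Qed.

Lemma sqr_cmod z : cmod z ^+ 2 = sqmod z.
Proof. by rewrite sqr_sqrtr ?sqmod_ge0. Qed.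

Lemma cmodD z w : cmod (z + w) <= cmod z + cmod w.
Proof. by rewrite -lecR real_complexD -!sqmod_norm ler_normD. Qed.

Lemma cmod_sum (I : Type) (s : seq I) (c : I -> R[i]) :
  cmod (\sum_(i <- s) c i) <= \sum_(i <- s) cmod (c i).
Proof.
elim: s => [|i s IH]; first by rewrite !big_nil /cmod sqmod0 sqrtr0.
by rewrite !big_cons (le_trans (cmodD _ _))// lerD2l.
Qed.

Lemma half_complex : (2^-1 : R[i]) = (2^-1 : R)%:C.
Proof. by rewrite fmorphV rmorph_nat. Qed.

End ComplexAbs.

(** * Pairings with orthonormal systems, and the upper bound *)

Section Pairing.
Context (R : realType) (H : completeNormedModType R[i]).
Variable dot : {dot H for Num.conj}.
Hypothesis dotP : is_inner_product dot.
Implicit Types (x y z : H) (S T : H -> H) (E : set H).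
Local Notation nsq := (nsq dot).
Local Notation bounded_linear := (bounded_linear dot).
Local Notation adj := (adjoint dot).
Local Notation ucompact := (ucompact dot).
Local Notation singular_basis := (singular_basis dot).
Local Notation onb := (orthonormal_basis dot).
Local Notation power_sum := (power_sum dot).

(** Truncate [x] to a finite Fourier sum; Cauchy-Schwarz bounds the rest by [r]. *)
Lemma cmod_dot_le E x y : onb E ->
  ((cmod (dot x y))%:E <= \esum_(e in E) (cmod (dot x e) * cmod (dot y e))%:E)%E.
Proof.
move=> bE; apply/lee_addgt0Pr => r r0.
have y1 : 0 < nsq y + 1 by rewrite ltr_wpDl ?nsq_ge0.
have rp : 0 < r ^+ 2 / (nsq y + 1) by rewrite divr_gt0 ?exprn_gt0.
have [s [us sE hs]] := basis_approx dotP x bE rp.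
set Px := \sum_(e <- s) _ in hs.
have -> : dot x y = dot Px y + dot (x - Px) y by rewrite -dotDl addrC subrK.
apply: (@le_trans _ _ ((\sum_(e <- s) cmod (dot x e) * cmod (dot y e))%:E + r%:E)%E).
  rewrite -EFinD lee_fin; apply: (le_trans (cmodD _ _)); apply: lerD.
    rewrite /Px dot_suml; apply: (le_trans (cmod_sum _ _)).
    by apply: ler_sum => e _; rewrite cmodM (dotC dot y) cmodJ.
  rewrite -[leRHS](ger0_norm (ltW r0)) -sqrtr_sqr ler_wsqrtr//.
  apply: (le_trans (cauchy_schwarz _ _ _)).
  have := nsq_ge0 dot (x - Px); have := nsq_ge0 dot y.
  move: hs; rewrite ltr_pdivlMr//; move: (nsq (x - Px)) (nsq y) => a b; nra.
by rewrite leeD2r//; exact: esum_ge_seq.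
Qed.

(* Orthonormal, up to vanishing members: left singular vectors are normalized
   with [0^-1 = 0]. *)
Definition orthonormal0 (I : choiceType) (J : set I) (v : I -> H) :=
  forall i j, J i -> J j -> v i <> 0 -> v j <> 0 -> dot (v i) (v j) = (i == j)%:R.

Lemma bessel0 (I : choiceType) (J : set I) (v : I -> H) x : orthonormal0 J v ->
  (\esum_(i in J) (sqmod (dot x (v i)))%:E <= (nsq x)%:E)%E.
Proof.
move=> oJ; apply: esum_le_seq => s us sJ; rewrite lee_fin.
rewrite (bigID (fun i => v i == 0))/= big1 ?add0r; last first.
  by move=> i /eqP ->; rewrite dot0r sqmod0.
rewrite -big_filter.
apply: (@bessel_seq _ _ _ _ (J `&` [set i | v i <> 0])).
- by move=> i j [Ji vi] [Jj vj]; exact: oJ.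
- exact: filter_uniq.
- by move=> i; rewrite mem_filter => /andP[/eqP vi /sJ].
Qed.

Lemma orthonormal0_nsq (I : choiceType) (J : set I) (v : I -> H) i :
  orthonormal0 J v -> J i -> nsq (v i) <= 1.
Proof.
move=> oJ Ji; have [->|/eqP v0] := eqVneq (v i) 0; first by rewrite nsq0.
by rewrite /nsq oJ// eqxx.
Qed.

Definition left_vector T e := (Num.sqrt (nsq (T e)))^-1%:C *: T e.

Lemma left_vectorK T e : (Num.sqrt (nsq (T e)))%:C *: left_vector T e = T e.
Proof.
rewrite /left_vector scalerA -real_complexM.
have [h|h] := eqVneq (Num.sqrt (nsq (T e))) 0; last by rewrite mulfV// scale1r.
rewrite h mul0r scale0r; apply/esym/(nsq_eq0 (dot := dot)).
by rewrite -(sqr_sqrtr (nsq_ge0 dot (T e))) h expr0n.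
Qed.

Lemma left_vector_orthonormal0 T E : bounded_linear T -> singular_basis T E ->
  orthonormal0 E (left_vector T).
Proof.
move=> bT [bE hE] e f Ee Ef e0 f0.
have Tfp : 0 < Num.sqrt (nsq (T f)).
  rewrite lt_def sqrtr_ge0 andbT; apply/eqP => h; apply: f0.
  by rewrite /left_vector h invr0 scale0r.
rewrite /left_vector dotZl dotZr conjC_real (adjointE_r dotP)// hE// dotZl.
rewrite bE.1//; case: eqP => [ef|_]; last by rewrite !mulr0.
rewrite -ef in Tfp *; rewrite mulr1 -!real_complexM.
rewrite -[X in (_ * (_ * X))%:C](sqr_sqrtr (nsq_ge0 dot (T e))).
rewrite (_ : _ * _ = 1)//; field; rewrite gt_eqF//.
Qed.

(** The singular expansion bounds [cmod (dot (T (u i)) (v i))] by the average of the singular values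
    [l e] with weights [w i e], whose row and column sums are at most 1 by Bessel. *)
Lemma pairing_bound (p : R) T E (I : choiceType) (J : set I) (u v : I -> H) :
  1 <= p -> bounded_linear T -> singular_basis T E ->
  orthonormal0 J u -> orthonormal0 J v ->
  (\esum_(i in J) (cmod (dot (T (u i)) (v i)) `^ p)%:E <= power_sum (p / 2) T E)%E.
Proof.
move=> p1 bT sE ou ov; have [bE hE] := sE.
have og := left_vector_orthonormal0 bT sE.
pose l e := Num.sqrt (nsq (T e)); pose g := left_vector T.
pose w i e := 2^-1 * (sqmod (dot (u i) e) + sqmod (dot (v i) (g e))).
have -> : power_sum (p / 2) T E = (\esum_(e in E) (l e `^ p)%:E)%E.
  apply: eq_esum => e _; rewrite /l -powR12_sqrt ?nsq_ge0// -powRrM.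
  by rewrite [2^-1 * p]mulrC.
have w0 i e : 0 <= w i e by rewrite mulr_ge0// addr_ge0 ?sqmod_ge0.
have split_half (A : choiceType) (B : set A) (f h : A -> R) :
    (forall a, 0 <= f a) -> (forall a, 0 <= h a) ->
    (\esum_(a in B) (f a)%:E <= 1)%E -> (\esum_(a in B) (h a)%:E <= 1)%E ->
    (\esum_(a in B) (2^-1 * (f a + h a))%:E <= 1)%E.
  move=> f0 h0 f1 h1; rewrite esumZl//; last by move=> a _; rewrite addr_ge0.
  under eq_esum do rewrite EFinD.
  rewrite esumD; [|by move=> *; rewrite lee_fin..].
  rewrite -[leRHS](_ : 2^-1%:E * 2%:E = 1)%E; last by rewrite -EFinM mulVf// pnatr_eq0.
  apply: lee_wpmul2l; first by rewrite lee_fin.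
  by rewrite -[2]/(1 + 1) EFinD leeD.
apply: (double_convex (w := w)) => //.
- by move=> e _; exact: sqrtr_ge0.
- by move=> i _; exact: cmod_ge0.
- move=> i Ji; apply: split_half; try by move=> a; exact: sqmod_ge0.
    apply: (le_trans (bessel (basis_orthonormal bE) (u i))).
    by rewrite lee_fin (orthonormal0_nsq ou).
  apply: (le_trans (bessel0 (v i) og)).
  by rewrite lee_fin (orthonormal0_nsq ov).
- move=> e Ee; apply: split_half; try by move=> a; exact: sqmod_ge0.
    under eq_esum do rewrite dotC sqmodJ.
    by apply: (le_trans (bessel0 e ou)); rewrite lee_fin (nsq_basis bE Ee).
  under eq_esum do rewrite dotC sqmodJ.
  apply: (le_trans (bessel0 (g e) ov)).
  by rewrite lee_fin (orthonormal0_nsq og).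
move=> i Ji; rewrite (adjointE dotP)//.
apply: (le_trans (cmod_dot_le _ _ bE)); apply: le_esum => e Ee; rewrite lee_fin.
rewrite -(adjointE_r dotP)// -[T e]left_vectorK dotZr conjC_real cmodM cmodr ?sqrtr_ge0//.
rewrite -/(l e) -/(g e) mulrCA mulrC ler_wpM2r ?sqrtr_ge0// /w.
(* The product of two moduli is at most half the sum of their squares. *)
rewrite -!sqr_cmod; have := sqr_ge0 (cmod (dot (u i) e) - cmod (dot (v i) (g e))).
lra.
Qed.

Lemma power_sum_re_le (p : R) (c : R[i]) A B E F : 1 <= p -> sqmod c = 1 ->
  bounded_linear A -> bounded_linear B ->
  (forall x, B x = 2^-1 *: (c *: A x + Num.conj c *: adj A x)) ->
  singular_basis A E -> singular_basis B F ->
  (power_sum (p / 2) B F <= power_sum (p / 2) A E)%E.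
Proof.
move=> p1 c1 bA bB hB sE sF; have [bF hF] := sF.
have ov := left_vector_orthonormal0 bB sF.
have ou : orthonormal0 F id by move=> e f Fe Ff _ _; exact: bF.1.
have h1 := pairing_bound p1 bA sE ou ov; have h2 := pairing_bound p1 bA sE ov ou.
pose a x y := cmod (dot (A x) y).
have c1' : cmod c = 1 by rewrite /cmod c1 sqrtr1.
have p0 : 0 <= p by rewrite (le_trans _ p1).
apply: (@le_trans _ _ (\esum_(f in F)
    (2^-1 * (a f (left_vector B f) `^ p + a (left_vector B f) f `^ p))%:E)%E).
  apply: le_esum => f Ff; rewrite lee_fin.
  set s := Num.sqrt (nsq (B f)); set v := left_vector B f.
  have -> : nsq (B f) `^ (p / 2) = s `^ p.
    by rewrite /s -powR12_sqrt ?nsq_ge0// -powRrM [2^-1 * p]mulrC.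
  (* This remains true for [s = 0], where [v = 0]. *)
  have sv : dot (B f) v = s%:C.
    rewrite /v /left_vector dotZr conjC_real dotxx -real_complexM; congr (_%:C).
    rewrite -/s -(sqr_sqrtr (nsq_ge0 dot (B f))) -/s.
    by have [->|s0] := eqVneq s 0; [rewrite expr0n mulr0|field].
  have : s <= (a f v + a v f) / 2.
    have -> : s = cmod (dot (B f) v) by rewrite sv cmodr ?sqrtr_ge0.
    rewrite hB dotZl half_complex cmodM cmodr// mulrC.
    rewrite ler_pM2r// dotDl !dotZl; apply: (le_trans (cmodD _ _)).
    rewrite !cmodM cmodJ c1' !mul1r lerD2l.
    by rewrite -(adjointE_r dotP)// dotC cmodJ.
  move=> sa; rewrite [leRHS]mulrC.
  apply: (@le_trans _ _ (((a f v + a v f) / 2) `^ p)).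
    by apply: ge0_ler_powR => //; rewrite nnegrE ?sqrtr_ge0// divr_ge0// addr_ge0// cmod_ge0.
  by apply: powR_mid_convex; rewrite ?cmod_ge0.
rewrite esumZl//; last by move=> f _; rewrite addr_ge0// powR_ge0.
under eq_esum do rewrite EFinD.
rewrite esumD; [|by move=> *; rewrite lee_fin powR_ge0..].
set N := power_sum _ A E in h1 h2 *.
have N0 : (0 <= N)%E by apply: esum_ge0 => e _; rewrite lee_fin powR_ge0.
rewrite -[N](half_doubleE N0).
apply: lee_wpmul2l; first by rewrite lee_fin invr_ge0.
exact: (leeD h1 h2).
Qed.

End Pairing.

(** * Real and imaginary parts, and the lower bounds *)

Section RealPart.
Context (R : realType) (H : completeNormedModType R[i]).
Variable dot : {dot H for Num.conj}.
Hypothesis dotP : is_inner_product dot.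
Implicit Types (x y z : H) (S T : H -> H) (E : set H).
Local Notation nsq := (nsq dot).
Local Notation bounded_linear := (bounded_linear dot).
Local Notation adj := (adjoint dot).
Local Notation ucompact := (ucompact dot).
Local Notation singular_basis := (singular_basis dot).
Local Notation onb := (orthonormal_basis dot).
Local Notation power_sum := (power_sum dot).
Local Notation re_op := (re_op dot).

Lemma adjointZ (c : R[i]) T : bounded_linear T ->
  adj (fun x => c *: T x) = (fun x => Num.conj c *: adj T x).
Proof.
move=> bT; apply: adjoint_unique => x y.
by rewrite dotZl dotZr conjCK (adjointE dotP).
Qed.

Lemma re_op_bounded T : bounded_linear T -> bounded_linear (re_op T).
Proof.
move=> bT; apply: bounded_linearZ; apply: bounded_linearD => //.
exact: bounded_linear_adjoint.
Qed.

Lemma re_op_ucompact T : linear T -> ucompact T -> ucompact (re_op T).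
Proof.
by move=> lT cT; apply: ucompactZ; apply: ucompactD => //; exact: ucompact_adjoint.
Qed.

Lemma re_op_adjoint T : bounded_linear T -> adj (re_op T) = re_op T.
Proof.
move=> bT; apply: adjoint_unique => x y; rewrite /Defs.re_op.
rewrite dotZl dotZr half_complex conjC_real; congr (_ * _).
by rewrite dotDl dotDr (adjointE_r dotP)// (adjointE dotP)// addrC.
Qed.

(** The two vectors are half of [T x + adj T x] and, up to the factor ['i], half of [adj T x - T x];
    apply the parallelogram law. *)
Lemma nsq_re_im T x : bounded_linear T ->
  nsq (re_op T x) + nsq (re_op (fun z => - 'i *: T z) x)
    = (nsq (T x) + nsq (adj T x)) / 2.
Proof.
move=> bT; rewrite /Defs.re_op (adjointZ _ bT) rmorphN /= conjCi opprK.
rewrite (_ : - 'i *: T x + _ = 'i *: (adj T x - T x)); last first.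
  by rewrite scaleNr addrC -scalerBr.
rewrite !nsqZ nsqBC half_complex !sqmod_real.
have -> : sqmod 'i = 1 :> R.
  by rewrite -complexiE /sqmod /= expr0n expr1n add0r.
by rewrite mul1r -mulrDr parallelogram; field.
Qed.

(** It provides the one basis [D] in which all the operators are then compared. *)
Lemma spectral_sum X Y : linear X -> linear Y -> ucompact X -> ucompact Y ->
  exists D, onb D /\ forall d, D d ->
    adj X (X d) + adj Y (Y d) = (nsq (X d) + nsq (Y d))%:C *: d.
Proof.
move=> lX lY cX cY; have bX := ucompact_bounded lX cX; have bY := ucompact_bounded lY cY.
have bX' := bounded_linear_adjoint dotP bX; have bY' := bounded_linear_adjoint dotP bY.
have e x y : dot (adj X (X x) + adj Y (Y x)) y = dot (X x) (X y) + dot (Y x) (Y y).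
  by rewrite dotDl !(adjointE_r dotP).
have [|||D [bD hD]] := @spectral_theorem _ _ dot (fun x => adj X (X x) + adj Y (Y x))
  (bounded_linearD (bounded_linear_comp bX' bX) (bounded_linear_comp bY' bY)).
- by apply: ucompactD; exact: ucompact_compl.
- by move=> x y /=; rewrite e dotC [in RHS]dotC e !rmorphD /= -!dotC.
- by move=> x /=; rewrite e ReD addr_ge0// nsq_ge0.
by exists D; split=> // d Dd; rewrite hD//= e ReD.
Qed.

Section Bounds.
Context (A : H -> H) (lA : linear A) (cA : ucompact A) (E F G : set H).
Let bA := ucompact_bounded lA cA.
Let B := re_op A.
Let C := re_op (fun z => - 'i *: A z).
Hypotheses (sE : singular_basis A E) (sF : singular_basis B F)
  (sG : singular_basis C G).

Let lB : linear B. Proof. exact: (re_op_bounded bA).1. Qed.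
Let cB : ucompact B. Proof. exact: re_op_ucompact. Qed.
Let biA : bounded_linear (fun z => - 'i *: A z). Proof. exact: bounded_linearZ. Qed.
Let lC : linear C. Proof. exact: (re_op_bounded biA).1. Qed.
Let cC : ucompact C.
Proof. by apply: re_op_ucompact; [exact: biA.1|exact: ucompactZ]. Qed.
Let aB : adj B = B. Proof. exact: re_op_adjoint. Qed.
Let aC : adj C = C. Proof. exact: re_op_adjoint. Qed.
Let bB := ucompact_bounded lB cB.
Let bC := ucompact_bounded lC cC.
Let BC x : nsq (B x) + nsq (C x) = (nsq (A x) + nsq (adj A x)) / 2.
Proof. exact: nsq_re_im. Qed.

Lemma power_sum_re_im_concave q : 0 < q <= 1 ->
  (power_sum q A E <= power_sum q B F + power_sum q C G)%E.
Proof.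
move=> q01; have /andP[q0 _] := q01.
have cA' := ucompact_adjoint dotP lA cA; have bA' := bounded_linear_adjoint dotP bA.
have [E' sE'] := singular_basis_exists dotP bA'.1 cA'.
have sE2 : singular_basis (adj (adj A)) E by rewrite (adjointK dotP).
have [D [bD hD]] := spectral_sum lB lC cB cC.
have lS : linear (fun d => adj B (B d) + adj C (C d)).
  rewrite aB aC.
  exact: (bounded_linearD (bounded_linear_comp bB bB) (bounded_linear_comp bC bC)).1.
have quad x : complex.Re (dot (adj B (B x) + adj C (C x)) x)
    = nsq (adj B x) + nsq (adj C x).
  by rewrite aB aC dotDl ReD -{1}aB -{1}aC -!(adjointE_r dotP).
apply: le_trans (power_sum2_concave dotP bB bC sF.1 sG.1 bD lS hD quad q01).
have h1 := power_sum_adjoint_concave dotP bA sE' bD q01.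
have h2 := power_sum_adjoint_concave dotP bA' sE2 bD q01.
rewrite (adjointK dotP)// in h2.
rewrite -(power_sum_adjoint dotP bA q0 sE sE') in h1.
apply: (@le_trans _ _ (\esum_(d in D)
    (2^-1 * (nsq (A d) `^ q + nsq (adj A d) `^ q))%:E)%E); last first.
  apply: le_esum => d _; rewrite lee_fin BC mulrC.
  by apply: powR_mid_concave => //; exact: nsq_ge0.
rewrite esumZl//; last by move=> d _; rewrite addr_ge0// powR_ge0.
under eq_esum do rewrite EFinD.
rewrite esumD; [|by move=> *; rewrite lee_fin powR_ge0..].
set N := power_sum q A E in h1 h2 *.
have N0 : (0 <= N)%E by apply: esum_ge0 => e _; rewrite lee_fin powR_ge0.
rewrite -[N](half_doubleE N0).
apply: lee_wpmul2l; first by rewrite lee_fin invr_ge0.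
exact: (leeD h1 h2).
Qed.

Lemma power_sum_re_im_convex q : 1 <= q ->
  (power_sum q A E <= (2 `^ (2 * q - 2))%:E * (power_sum q B F + power_sum q C G))%E.
Proof.
move=> q1; have q0 : 0 < q by rewrite (lt_le_trans ltr01).
have cA' := ucompact_adjoint dotP lA cA; have bA' := bounded_linear_adjoint dotP bA.
have [E' sE'] := singular_basis_exists dotP bA'.1 cA'.
have sE2 : singular_basis (adj (adj A)) E by rewrite (adjointK dotP).
have [D [bD hD]] := spectral_sum lA bA'.1 cA cA'.
have lS : linear (fun d => adj A (A d) + adj (adj A) (adj A d)).
  rewrite (adjointK dotP)//.
  exact: (bounded_linearD (bounded_linear_comp bA' bA) (bounded_linear_comp bA bA')).1.
have quad x : complex.Re (dot (adj A (A x) + adj (adj A) (adj A x)) x)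
    = nsq (adj A x) + nsq (adj (adj A) x).
  rewrite (adjointK dotP)// dotDl ReD addrC.
  by rewrite (adjointE dotP)// -(adjointE_r dotP bA (A x)).
have := power_sum2_convex dotP bA bA' sE.1 sE'.1 bD lS hD quad q1.
rewrite -(power_sum_adjoint dotP bA q0 sE sE') => h.
have sF' : singular_basis (adj B) F by rewrite aB.
have sG' : singular_basis (adj C) G by rewrite aC.
have h1 := power_sum_adjoint_convex dotP bB sF' bD q1; rewrite aB in h1.
have h2 := power_sum_adjoint_convex dotP bC sG' bD q1; rewrite aC in h2.
set N := power_sum q A E in h *.
have N0 : (0 <= N)%E by apply: esum_ge0 => e _; rewrite lee_fin powR_ge0.
rewrite -[N](half_doubleE N0).
(* One factor 1/2 comes from the doubled power sum, the other from midpoint convexity. *)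
have -> : (2 `^ (2 * q - 2) = 2^-1 * (2 `^ (2 * q) / 2) :> R).
  rewrite powRB; last by rewrite pnatr_eq0 implybT.
  by rewrite (powR_mulrn 2)//; field.
rewrite EFinM -muleA; apply: lee_wpmul2l; first by rewrite lee_fin.
apply: (le_trans h).
apply: (@le_trans _ _ (\esum_(d in D)
    (2 `^ (2 * q) / 2 * (nsq (B d) `^ q + nsq (C d) `^ q))%:E)%E).
  apply: le_esum => d _; rewrite lee_fin.
  have -> : nsq (A d) + nsq (adj A d) = 2 ^+ 2 * ((nsq (B d) + nsq (C d)) / 2).
    by rewrite BC; field.
  rewrite powRM; [|by []|by rewrite divr_ge0// addr_ge0// nsq_ge0].
  rewrite -(powR_mulrn 2)// -powRrM -mulrA ler_wpM2l ?powR_ge0//.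
  by rewrite [leRHS]mulrC; apply: powR_mid_convex => //; exact: nsq_ge0.
rewrite esumZl; [|by rewrite divr_ge0// powR_ge0|by move=> d _; rewrite addr_ge0// powR_ge0].
under eq_esum do rewrite EFinD.
rewrite esumD; [|by move=> *; rewrite lee_fin powR_ge0..].
apply: lee_wpmul2l; first by rewrite lee_fin divr_ge0// powR_ge0.
exact: (leeD h1 h2).
Qed.

End Bounds.

End RealPart.

(** * From power sums to norms, and the final inequalities *)

Lemma poweR_inv_le (R : realType) (p k : R) (N W : \bar R) :
  0 < p -> 0 < k -> (0 <= N)%E -> (0 <= W)%E ->
  (N <= k%:E * W `^ p)%E -> ((k `^ (- p^-1))%:E * N `^ p^-1 <= W)%E.
Proof.
move=> p0 k0 N0 W0 h; have pi0 : 0 <= p^-1 by rewrite invr_ge0 ltW.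
have : (N `^ p^-1 <= (k%:E * W `^ p) `^ p^-1)%E.
  apply: gt0_ler_poweR => //; rewrite in_itv/= leey andbT//.
  by rewrite mule_ge0 ?poweR_ge0// lee_fin ltW.
rewrite poweRM ?poweR_ge0//; last by rewrite lee_fin ltW.
rewrite -poweRrM divff ?gt_eqF// poweRe1// poweR_EFin => h1.
have kp : 0 < k `^ (- p^-1) by rewrite powR_gt0.
rewrite -(@lee_pmul2l _ (k `^ (- p^-1))%:E) ?lte_fin// in h1.
apply: (le_trans h1).
by rewrite muleA -EFinM powRN mulVf ?mul1e// gt_eqF// powR_gt0.
Qed.

Theorem proposition5p5 (R : realType) (H : completeNormedModType R[i])
    (dot : {dot H for Num.conj}) (dotP : is_inner_product dot)
    (sepH : separable H) (p : R) (A : H -> H)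
    (AS : schatten_class dot p A) :
  (1 <= p <= 2 ->
    ((2 `^ (- p^-1))%:E * schatten_norm dot p A
       <= schatten_numerical_radius dot p A)%E /\
    (schatten_numerical_radius dot p A <= schatten_norm dot p A)%E) /\
  (2 <= p ->
    ((2 `^ (p^-1 - 1))%:E * schatten_norm dot p A
       <= schatten_numerical_radius dot p A)%E /\
    (schatten_numerical_radius dot p A <= schatten_norm dot p A)%E).
Proof.
have lA : linear A := AS.1.1.
have cA : ucompact dot A by apply: compact_ucompact => //; exact: AS.1.
have bA := ucompact_bounded lA cA.
set W := schatten_numerical_radius dot p A.
have re (c : R[i]) : linear (re_op dot (fun x => c *: A x)) /\
    ucompact dot (re_op dot (fun x => c *: A x)).
  split; first exact: (re_op_bounded dotP (bounded_linearZ c bA)).1.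
  by apply: re_op_ucompact => //; [exact: (bounded_linearZ c bA).1|exact: ucompactZ].
have ps0 q T E : (0 <= power_sum dot q T E)%E.
  by apply: esum_ge0 => e _; rewrite lee_fin powR_ge0.
have upper : 1 <= p -> (W <= schatten_norm dot p A)%E.
  move=> p1; have p0 : 0 < p by rewrite (lt_le_trans ltr01).
  have [E sE ->] := schatten_normE dotP p0 lA cA.
  apply: ge_ereal_sup => _ [theta _ <-].
  have [lB cB] := re (expi theta).
  have [F sF ->] := schatten_normE dotP p0 lB cB.
  have pi0 : 0 <= p^-1 by rewrite invr_ge0 ltW.
  apply: gt0_ler_poweR; rewrite ?in_itv/= ?leey ?andbT ?ps0//.
  have c1 : sqmod (expi theta) = 1 by rewrite /sqmod /= cos2Dsin2.
  apply: (power_sum_re_le dotP p1 c1 bA (ucompact_bounded lB cB) _ sE sF) => x.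
  by rewrite /re_op (adjointZ dotP _ bA).
(* The angles 0 and [- (pi / 2)] of the supremum give the real and imaginary parts of [A]. *)
have [B0 C0] : re_op dot (fun x => expi 0 *: A x) = re_op dot A /\
    re_op dot (fun x => expi (- (pi / 2)) *: A x) = re_op dot (fun x => - 'i *: A x).
  split; congr (re_op dot _); apply/funext => x.
    by rewrite /expi cos0 sin0 scale1r.
  rewrite /expi cosN sinN cos_pihalf sin_pihalf; congr (_ *: _).
  by rewrite -complexiE; apply/eqP; rewrite eq_complex /= oppr0 !eqxx.
have lower k : 1 <= p -> 0 < k ->
    (forall E F G, singular_basis dot A E -> singular_basis dot (re_op dot A) F ->
      singular_basis dot (re_op dot (fun x => - 'i *: A x)) G ->
      (power_sum dot (p / 2) A E <= (k / 2)%:E *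
        (power_sum dot (p / 2) (re_op dot A) F
         + power_sum dot (p / 2) (re_op dot (fun x => - 'i *: A x)) G))%E) ->
    ((k `^ (- p^-1))%:E * schatten_norm dot p A <= W)%E.
  move=> p1 k0 hk; have p0 : 0 < p by rewrite (lt_le_trans ltr01).
  have le_W (c : R[i]) theta :
      re_op dot (fun x => expi theta *: A x) = re_op dot (fun x => c *: A x) ->
      exists2 F, singular_basis dot (re_op dot (fun x => c *: A x)) F &
        (power_sum dot (p / 2) (re_op dot (fun x => c *: A x)) F <= W `^ p)%E.
    move=> hc; have [lB cB] := re c.
    have [F sF hF] := schatten_normE dotP p0 lB cB.
    exists F => //; have : (schatten_norm dot p (re_op dot (fun x => c *: A x)) <= W)%E.
      by apply: ereal_sup_ubound; exists theta => //; rewrite hc.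
    rewrite hF => h.
    have : ((power_sum dot (p / 2) (re_op dot (fun x => c *: A x)) F `^ p^-1) `^ p <= W `^ p)%E.
      apply: gt0_ler_poweR; rewrite ?in_itv/= ?leey ?andbT ?poweR_ge0 ?(ltW p0)//.
      by apply: le_trans h; exact: poweR_ge0.
    by rewrite -poweRrM mulVf ?gt_eqF// poweRe1// ps0.
  have A1 : (fun x => 1 *: A x) = A by apply/funext => x; rewrite scale1r.
  have [|F sF hF] := le_W 1 0; first by rewrite B0 A1.
  have [|G sG hG] := le_W (- 'i) (- (pi / 2)); first by rewrite C0.
  rewrite A1 in sF hF.
  have [E sE ->] := schatten_normE dotP p0 lA cA.
  apply: poweR_inv_le => //.
    (* [W] is nonnegative because it dominates the norm at the angle 0. *)
    have [E0 sE0 hE0] := schatten_normE dotP p0 (re 1).1 (re 1).2.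
    apply: (@le_trans _ _ (schatten_norm dot p (re_op dot (fun x => expi 0 *: A x)))).
      exact: poweR_ge0.
    by apply: ereal_sup_ubound; exists 0.
  apply: (le_trans (hk E F G sE sF sG)).
  apply: (@le_trans _ _ ((k / 2)%:E * (W `^ p + W `^ p))%E).
    apply: lee_wpmul2l; first by rewrite lee_fin divr_ge0// ltW.
    exact: (leeD hF hG).
  have k2 : 0 <= k / 2 by rewrite divr_ge0// ltW.
  rewrite ge0_muleDr ?poweR_ge0// -ge0_muleDl ?lee_fin//.
  by rewrite -EFinD -splitr.
split=> [/andP[p1 p2]|p2].
  split; last exact: upper.
  apply: lower => // E F G sE sF sG; rewrite divff ?pnatr_eq0// mul1e.
  by apply: (power_sum_re_im_concave dotP lA cA) => //; lra.
have p1 : 1 <= p by lra.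
split; last exact: upper.
have -> : 2 `^ (p^-1 - 1) = (2 `^ (p - 1)) `^ (- p^-1) :> R.
  by rewrite -powRrM; congr (_ `^ _); field; rewrite gt_eqF//; lra.
apply: lower => //.
move=> E F G sE sF sG.
(* The constant of the convex bound at [q = p / 2]. *)
have -> : 2 `^ (p - 1) / 2 = 2 `^ (2 * (p / 2) - 2) :> R.
  rewrite -[X in _ / X](powRr1 (ler0n _ 2)) -powRB ?pnatr_eq0 ?implybT//.
  by congr (_ `^ _); field.
by apply: (power_sum_re_im_convex dotP lA cA) => //; lra.
Qed.
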